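(* There is no maximal $K$-degree. That is, for every real $z\in 2^\omega$ there is a real $\hat z\in 2^\omega$ such that $z<_K\hat z$.
   Context: Fix an optimal (universal) prefix-free machine $U$, and for $\sigma\in 2^{<\omega}$ let $K(\sigma)=\min\{|p|:U(p)=\sigma\}$ be prefix-free Kolmogorov complexity. Reals are elements of $2^\omega$; $z\upharpoonright n$ is the prefix of $z$ of length $n$. For $z,\hat z\in 2^\omega$ write $z\leq_K\hat z$ if there is a constant $c$ such that $K(z\upharpoonright n)\leq K(\hat z\upharpoonright n)+c$ for all $n$; write $z=_K\hat z$ if $z\leq_K\hat z$ and $\hat z\leq_K z$; write $z<_K\hat z$ if $z\leq_K\hat z$ and $\hat z\not\leq_K z$. The $K$-degree of $z$ is $[z]_K=\{\hat z\in 2^\omega:\hat z=_K z\}$. A $K$-degree $[z]_K$ is maximal if there is no $\hat z\in 2^\omega$ with $z<_K\hat z$. *)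

(* Defs.v *)
From mathcomp Require Import all_boot.
From mathcomp Require Import boolp classical_sets.

Set Implicit Arguments.
Unset Strict Implicit.
Unset Printing Implicit Defensive.

(* Kleene's partial recursive functions of a list of natural numbers.  Terms
   carry no arity: arguments beyond the end of the list are read as 0. *)
Inductive recfun : Type :=
| Zero
| Succ
| Proj (i : nat)
| Comp (f : recfun) (gs : seq recfun)
| Prec (f g : recfun)
| Mu (f : recfun).

(* [eval f v y]: the computation of [f] on [v] halts with value [y].  The
   recursion variable of [Prec] and the search variable of [Mu] come first. *)
Inductive eval : recfun -> seq nat -> nat -> Prop :=
| eval_Zero v : eval Zero v 0
| eval_Succ v : eval Succ v (nth 0 v 0).+1
| eval_Proj i v : eval (Proj i) v (nth 0 v i)
| eval_Comp f gs v ws y :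
    size ws = size gs ->
    (forall i, i < size gs -> eval (nth Zero gs i) v (nth 0 ws i)) ->
    eval f ws y ->
    eval (Comp f gs) v y
| eval_Prec_nil f g y :
    eval f [::] y ->
    eval (Prec f g) [::] y
| eval_Prec_0 f g v y :
    eval f v y ->
    eval (Prec f g) (0 :: v) y
| eval_Prec_S f g n v r y :
    eval (Prec f g) (n :: v) r ->
    eval g (n :: r :: v) y ->
    eval (Prec f g) (n.+1 :: v) y
| eval_Mu f v n (r : nat -> nat) :
    eval f (n :: v) 0 ->
    (forall i, i < n -> eval f (i :: v) (r i).+1) ->
    eval (Mu f) v n.

(* Bijective base-2 numeration, least significant digit first: a bijection
   between binary strings and natural numbers. *)
Fixpoint code (s : seq bool) : nat :=
  if s is b :: s' then (code s').*2 + b.+1 else 0.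

(* [M p = Some s] is M(p) = s, and [M p = None] is divergence. *)
Definition machine := seq bool -> option (seq bool).

Definition partial_computable (M : machine) : Prop :=
  exists f : recfun, forall p s, M p = Some s <-> eval f [:: code p] (code s).

Definition prefix_free (M : machine) : Prop :=
  forall p q, M p <> None -> M q <> None -> prefix p q -> p = q.

Definition prefix_free_machine (M : machine) : Prop :=
  partial_computable M /\ prefix_free M.

(* K_U <= K_M + c for some c, where K_M(s) is infinite if s is not in the range
   of M. *)
Definition optimal (U : machine) : Prop :=
  prefix_free_machine U /\
  forall M, prefix_free_machine M ->
    exists c, forall p s, M p = Some s ->
      exists2 q, U q = Some s & size q <= size p + c.

(* The default value 0 is never used when U is optimal, since then every string
   is in the range of U. *)
Definition K (U : machine) (s : seq bool) : nat :=
  if pselect (exists n, `[< exists2 p, U p = Some s & size p = n >]) is left h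
  then ex_minn h else 0.

Definition real2 := nat -> bool.

Definition le_K (U : machine) (z zhat : real2) : Prop :=
  exists c, forall n, K U (mkseq z n) <= K U (mkseq zhat n) + c.

Definition eq_K (U : machine) (z zhat : real2) : Prop :=
  le_K U z zhat /\ le_K U zhat z.

Definition lt_K (U : machine) (z zhat : real2) : Prop :=
  le_K U z zhat /\ ~ le_K U zhat z.

Definition K_degree (U : machine) (z : real2) : set real2 :=
  [set zhat | eq_K U zhat z]%classic.

Definition maximal_K_degree (U : machine) (D : set real2) : Prop :=
  exists2 z, D = K_degree U z & ~ exists zhat, lt_K U z zhat.

(* Main.v *)
Require Import Defs.
From mathcomp Require Import all_boot.
From mathcomp Require Import boolp classical_sets.
From mathcomp Require Import zify.

Set Implicit Arguments.
Unset Strict Implicit.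
Unset Printing Implicit Defensive.

(**
Cut the positions into consecutive blocks of length 2D+1, with D growing very
slowly, and read a block as a number, least significant bit first.  On numbers
below 2^(2D+1), let phi be the permutation which, for every odd o < 2^(D+1),
runs through the cycle o -> 2o -> 4o -> ... -> 2^D o -> o, and fixes everything
else; let zhat be z with phi applied to every block.

A prefix of z is computed from the prefix of zhat of the same length and three
bits of advice: complete blocks are inverted, and in the last, incomplete block
the bits were left alone, shifted right by one (losing one bit) or shifted left
by D (losing D zeros).  Hence z <=_K zhat.

Suppose that also zhat <=_K z.  If a block of z is 2^D o, that is, 0^D 1 rho,
then its first D+1 bits are determined by their position, while the same number
of bits of zhat determines the whole block.  So the 2D+1 bits of the block
increase K(z | n) by O(1) only.  Group the blocks into windows with so
many blocks that a window without such a block is rare and can itself be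
compressed.  Every window then contributes an unbounded saving, so that
K(z | n) <= n + O(1), and K(z | n) - n is unbounded below.  Then every r with
K(r | n) >= n for all n satisfies z <_K r.
*)

(** * Computable functions on tuples of numbers *)

(** The length is fixed because terms carry no arity; nothing is claimed about [F] on lists of other
    lengths. *)
Definition computable (m : nat) (F : seq nat -> nat) : Prop :=
  exists f, forall v, size v = m -> eval f v (F v).

Lemma comp_ext m F F' :
  (forall v, size v = m -> F v = F' v) -> computable m F -> computable m F'.
Proof.
by move=> FE [f Hf]; exists f => v sv; rewrite -FE //; apply: Hf.
Qed.

Lemma comp_compose m F (Gs : seq (seq nat -> nat)) :
  computable (size Gs) F -> (forall i, i < size Gs -> computable m (nth (fun=> 0) Gs i)) ->
  computable m (fun v => F [seq G v | G <- Gs]).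
Proof.
move=> [f Hf] HG.
have [gs [sgs Hgs]] : exists gs, size gs = size Gs /\
    forall v i, size v = m -> i < size Gs ->
      eval (nth Zero gs i) v (nth (fun=> 0) Gs i v).
  elim: Gs HG {Hf} => [|G Gs IH] HG; first by exists [::].
  case: IH => [i|gs [sgs Hgs]]; first exact: (HG i.+1).
  have [g Hg] := HG 0 isT.
  exists (g :: gs); split=> [|v [|i] sv]; rewrite /= ?sgs //; first by move=> _; apply: Hg.
  exact: Hgs.
exists (Comp f gs) => v sv; apply: (@eval_Comp _ _ _ [seq G v | G <- Gs]).
- by rewrite size_map.
- by move=> i; rewrite sgs => Hi; rewrite (nth_map (fun=> 0)) //; apply: Hgs.
- by apply: Hf; rewrite size_map.
Qed.

Lemma comp_nth m i : computable m (fun v => nth 0 v i).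
Proof. by exists (Proj i) => v _; apply: eval_Proj. Qed.

Lemma comp_nthb m i : computable m (fun v => nth 0 (behead v) i).
Proof. by apply: comp_ext (comp_nth m i.+1) => v _; rewrite nth_behead. Qed.

Lemma comp_nthbb m i : computable m (fun v => nth 0 (behead (behead v)) i).
Proof. by apply: comp_ext (comp_nth m i.+2) => v _; rewrite !nth_behead. Qed.

Lemma comp_fun1 m g a : computable 1 (fun v => g (nth 0 v 0)) -> computable m a ->
  computable m (fun v => g (a v)).
Proof.
by move=> Hg Ha; apply: (@comp_compose m _ [:: a] Hg) => -[].
Qed.

Lemma comp_fun2 m g a b : computable 2 (fun v => g (nth 0 v 0) (nth 0 v 1)) ->
  computable m a -> computable m b -> computable m (fun v => g (a v) (b v)).
Proof.
by move=> Hg Ha Hb; apply: (@comp_compose m _ [:: a; b] Hg) => -[|[]].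
Qed.

Lemma comp_fun3 m g a b c :
  computable 3 (fun v => g (nth 0 v 0) (nth 0 v 1) (nth 0 v 2)) ->
  computable m a -> computable m b -> computable m c -> computable m (fun v => g (a v) (b v) (c v)).
Proof.
by move=> Hg Ha Hb Hc; apply: (@comp_compose m _ [:: a; b; c] Hg) => -[|[|[]]].
Qed.

Lemma behead2 T (w : seq T) : behead (behead w) = drop 2 w.
Proof. by case: w => [|x [|y w]]; rewrite //= drop0. Qed.

Lemma drop_map_nth k m w : size w = k + m ->
  drop k w = [seq G w | G <- [seq (fun w => nth 0 w (k + i)) | i <- iota 0 m]].
Proof.
move=> sw; rewrite -map_comp -[LHS](mkseq_nth 0) size_drop sw addKn.
by apply: eq_map => i /=; rewrite nth_drop.
Qed.

Lemma comp_nth_seq k m n i : computable n (nth (fun=> 0) [seq (fun w => nth 0 w (k + i)) | i <- iota 0 m] i).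
Proof.
case: (ltnP i m) => Hi; last first.
  rewrite nth_default ?size_map ?size_iota //.
  by exists Zero => v _; apply: eval_Zero.
by rewrite (nth_map 0) ?size_iota //; apply: comp_nth.
Qed.

Lemma comp_cons m F a : computable m.+1 F -> computable m a ->
  computable m (fun v => F (a v :: v)).
Proof.
move=> HF Ha; pose Gs := a :: [seq (fun v => nth 0 v (0 + i)) | i <- iota 0 m].
have sG : size Gs = m.+1 by rewrite /= size_map size_iota.
apply: (@comp_ext _ (fun v => F [seq G v | G <- Gs])).
  by move=> v sv; have := @drop_map_nth 0 m v sv; rewrite drop0 /Gs /= => <-.
by apply: comp_compose => [|[|i] _]; rewrite ?sG //; apply: comp_nth_seq.
Qed.

(** The step of a [Prec] sees index, accumulator and parameters; this removes the accumulator, so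
    that a function of index and parameters can serve inside the step. *)
Lemma comp_skip m (f : nat -> seq nat -> nat) :
  computable m.+1 (fun w => f (nth 0 w 0) (behead w)) ->
  computable m.+2 (fun w => f (nth 0 w 0) (behead (behead w))).
Proof.
move=> Hf.
pose Gs := (fun w => nth 0 w 0) :: [seq (fun w => nth 0 w (2 + i)) | i <- iota 0 m].
have sG : size Gs = m.+1 by rewrite /= size_map size_iota.
apply: (@comp_ext _ (fun w => f (nth 0 [seq G w | G <- Gs] 0) (behead [seq G w | G <- Gs]))).
  by move=> w sw; rewrite behead2 /= (@drop_map_nth 2 m).
apply: (@comp_compose _ (fun w => f (nth 0 w 0) (behead w))); rewrite sG // => -[|i] _.
  exact: comp_nth.
exact: comp_nth_seq.
Qed.

Lemma comp_rec m F A B a :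
  (forall v, F 0 v = A v) -> (forall n v, F n.+1 v = B (n :: F n v :: v)) ->
  computable m A -> computable m.+2 B -> computable m a -> computable m (fun v => F (a v) v).
Proof.
move=> F0 FS [f Hf] [g Hg] Ha.
pose F' v := F (head 0 v) (behead v).
apply: (@comp_cons _ F') => //; exists (Prec f g) => -[//|n v] [sv]; rewrite /F' /=.
elim: n => [|n IH]; first by rewrite F0; apply/eval_Prec_0/Hf.
by rewrite FS; apply: (eval_Prec_S IH); apply: Hg; rewrite /= sv.
Qed.

Lemma comp_S m a : computable m a -> computable m (fun v => (a v).+1).
Proof.
by move=> Ha; apply: (@comp_fun1 _ S) Ha; exists Succ => v _; apply: eval_Succ.
Qed.

Lemma comp_const m n : computable m (fun=> n).
Proof.
elim: n => [|n IH]; last exact: comp_S IH.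
by exists Zero => v _; apply: eval_Zero.
Qed.

Lemma comp_predn m a : computable m a -> computable m (fun v => (a v).-1).
Proof.
apply: comp_fun1; apply: (@comp_rec _ (fun n _ => n.-1) (fun=> 0) (fun w => nth 0 w 0)) => //.
- exact: comp_const.
- exact: comp_nth.
- exact: comp_nth.
Qed.

Lemma comp_addn m a b : computable m a -> computable m b -> computable m (fun v => a v + b v).
Proof.
apply: comp_fun2.
apply: (@comp_rec _ (fun n v => n + nth 0 v 1) (fun v => nth 0 v 1)
  (fun w => (nth 0 w 1).+1)) => //.
- exact: comp_nth.
- exact/comp_S/comp_nth.
- exact: comp_nth.
Qed.

Lemma comp_subn m a b : computable m a -> computable m b -> computable m (fun v => a v - b v).
Proof.
apply: comp_fun2.
apply: (@comp_rec _ (fun n v => nth 0 v 0 - n) (fun v => nth 0 v 0)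
  (fun w => (nth 0 w 1).-1)) => //; try exact: comp_nth.
- by move=> v; rewrite subn0.
- by move=> n v; rewrite subnS.
- exact/comp_predn/comp_nth.
Qed.

Lemma comp_muln m a b : computable m a -> computable m b -> computable m (fun v => a v * b v).
Proof.
apply: comp_fun2.
apply: (@comp_rec _ (fun n v => n * nth 0 v 1) (fun=> 0)
  (fun w => nth 0 w 3 + nth 0 w 1)) => //; try exact: comp_nth.
- exact: comp_const.
- by apply: comp_addn; apply: comp_nth.
Qed.

Lemma comp_expn m a b : computable m a -> computable m b -> computable m (fun v => a v ^ b v).
Proof.
move=> Ha Hb; apply: (@comp_fun2 _ (fun y x => x ^ y)) Hb Ha.
apply: (@comp_rec _ (fun n v => nth 0 v 1 ^ n) (fun=> 1)
  (fun w => nth 0 w 3 * nth 0 w 1)); try exact: comp_nth.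
- by [].
- by move=> n v; rewrite expnS.
- exact: comp_const.
- by apply: comp_muln; apply: comp_nth.
Qed.

Lemma comp_sum m (f : nat -> seq nat -> nat) a :
  computable m.+1 (fun w => f (nth 0 w 0) (behead w)) -> computable m a ->
  computable m (fun v => \sum_(0 <= i < a v) f i v).
Proof.
move=> Hf; apply: (@comp_rec _ (fun n v => \sum_(0 <= i < n) f i v) (fun=> 0)
  (fun w => nth 0 w 1 + f (nth 0 w 0) (behead (behead w)))).
- by move=> v; rewrite big_geq.
- by move=> n v; rewrite big_nat_recr.
- exact: comp_const.
- by apply: comp_addn; [exact: comp_nth|exact: comp_skip].
Qed.

Lemma comp_eq0 m a : computable m a -> computable m (fun v => a v == 0 : nat).
Proof.
move=> Ha; apply: (@comp_ext _ (fun v => 1 - a v)) => [v _|]; first by case: (a v).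
by apply: comp_subn => //; apply: comp_const.
Qed.

Lemma comp_leq m a b : computable m a -> computable m b -> computable m (fun v => a v <= b v : nat).
Proof. by move=> Ha Hb; rewrite /leq; apply/comp_eq0/comp_subn. Qed.

Lemma comp_neg m (p : seq nat -> bool) :
  computable m (fun v => p v : nat) -> computable m (fun v => ~~ p v : nat).
Proof.
by move=> Hp; apply: comp_ext (comp_eq0 Hp) => v _; case: (p v).
Qed.

Lemma comp_and m (p q : seq nat -> bool) : computable m (fun v => p v : nat) ->
  computable m (fun v => q v : nat) -> computable m (fun v => p v && q v : nat).
Proof.
move=> Hp Hq; apply: comp_ext (comp_muln Hp Hq) => v _.
by case: (p v); case: (q v).
Qed.

Lemma comp_if m (p : seq nat -> bool) a b : computable m (fun v => p v : nat) ->
  computable m a -> computable m b -> computable m (fun v => if p v then a v else b v).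
Proof.
move=> Hp Ha Hb.
apply: comp_ext (comp_addn (comp_muln Hp Ha) (comp_muln (comp_neg Hp) Hb)) => v _.
by case: (p v); rewrite mul1n mul0n ?addn0.
Qed.

Lemma comp_ifb m (p q r : seq nat -> bool) : computable m (fun v => p v : nat) ->
  computable m (fun v => q v : nat) -> computable m (fun v => r v : nat) ->
  computable m (fun v => (if p v then q v else r v) : nat).
Proof.
move=> Hp Hq Hr; apply: comp_ext (comp_if Hp Hq Hr) => v _.
by case: (p v).
Qed.

Lemma comp_eqn m a b : computable m a -> computable m b -> computable m (fun v => a v == b v : nat).
Proof.
move=> Ha Hb; apply: (@comp_ext _ (fun v => (a v <= b v) && (b v <= a v) : nat)).
  by move=> v _; rewrite -eqn_leq.
by apply: comp_and; apply: comp_leq.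
Qed.

Lemma sum_bool_count (p : pred nat) n :
  \sum_(0 <= i < n) p i = count p (iota 0 n).
Proof. by rewrite -sum1_count [RHS]big_mkcond /index_iota subn0. Qed.

Lemma comp_divn m a b : computable m a -> computable m b -> computable m (fun v => a v %/ b v).
Proof.
apply: comp_fun2.
(* The quotient counts the positive multiples of the divisor up to the dividend; the guard yields 0
   for division by 0. *)
apply: (@comp_ext _ (fun v => \sum_(0 <= i < nth 0 v 0)
  ((0 < nth 0 v 1) && (i.+1 * nth 0 v 1 <= nth 0 v 0)))) => [v _|].
  move: (nth 0 v 0) (nth 0 v 1) => {v} x [|d]; first by rewrite divn0 big1.
  rewrite (sum_bool_count (fun i => _ && _)) -size_filter; set s := filter _ _.
  have -> : s = iota 0 (x %/ d.+1).
    apply: (@irr_sorted_eq _ ltn); rewrite ?iota_ltn_sorted //.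
    - exact: ltn_trans.
    - exact: ltnn.
    - by apply: sorted_filter; [exact: ltn_trans|exact: iota_ltn_sorted].
    move=> i; rewrite mem_filter !mem_iota /= -leq_divRL //.
    by have := leq_div x d.+1; lia.
  by rewrite size_iota.
apply: comp_sum; last exact: comp_nth.
apply: comp_and; apply: comp_leq; try exact: comp_nthb.
- exact: comp_const.
- by apply: comp_muln; [apply/comp_S/comp_nth|apply: comp_nthb].
Qed.

Lemma comp_modn m a b : computable m a -> computable m b -> computable m (fun v => a v %% b v).
Proof.
move=> Ha Hb; apply: (@comp_ext _ (fun v => a v - a v %/ b v * b v)).
  by move=> v _; rewrite {1}(divn_eq (a v) (b v)) addKn.
by apply: comp_subn => //; apply: comp_muln => //; apply: comp_divn.
Qed.

Lemma comp_odd m a : computable m a -> computable m (fun v => odd (a v) : nat).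
Proof.
move=> Ha; apply: (@comp_ext _ (fun v => a v %% 2)) => [v _|]; first by rewrite modn2.
by apply: comp_modn => //; apply: comp_const.
Qed.

Lemma comp_has m (p : nat -> seq nat -> bool) a :
  computable m.+1 (fun w => p (nth 0 w 0) (behead w) : nat) -> computable m a ->
  computable m (fun v => has (p^~ v) (iota 0 (a v)) : nat).
Proof.
move=> Hp Ha; apply: comp_ext (comp_leq (comp_const m 1) 
  (@comp_sum _ (fun i v => p i v : nat) _ Hp Ha)) => v _.
by rewrite (sum_bool_count (p^~ v)) -has_count.
Qed.

Lemma comp_find m (p : nat -> seq nat -> bool) a :
  computable m.+1 (fun w => p (nth 0 w 0) (behead w) : nat) -> computable m a ->
  computable m (fun v => find (p^~ v) (iota 0 (a v))).
Proof.
move=> Hp Ha.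
(* The first hit is the number of [i] such that [p] fails on all of 0, ..., i. *)
apply: (@comp_ext _ (fun v => \sum_(0 <= i < a v) ~~ has (p^~ v) (iota 0 i.+1))).
  move=> v _; pose q i := ~~ has (p^~ v) (iota 0 i.+1).
  rewrite (sum_bool_count q) -size_filter; elim: (a v) => // n IH.
  rewrite -addn1 iotaD filter_cat size_cat IH find_cat size_iota /= add0n.
  have -> : q n = ~~ has (p^~ v) (iota 0 n) && ~~ p n v.
    by rewrite /q -addn1 iotaD has_cat /= add0n orbF negb_or.
  case: (boolP (has _ _)) => h //=; first by rewrite addn0.
  rewrite hasNfind // size_iota; by case: (p n v).
apply: comp_sum => //; apply: comp_neg.
apply: (@comp_ext _ (fun w => has (fun i => p i (behead w)) (iota 0 (nth 0 w 0).+1) : nat)) => //.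
apply: (@comp_has _ (fun i w => p i (behead w))); last exact/comp_S/comp_nth.
exact: (@comp_skip _ (fun i v => p i v : nat)).
Qed.

(** * Binary strings as numbers *)

Definition bit (n i : nat) : bool := odd (n %/ 2 ^ i).

Definition val2 (f : nat -> bool) (L : nat) : nat := \sum_(0 <= i < L) f i * 2 ^ i.

Lemma eq_val2 f g L : (forall i, i < L -> f i = g i) -> val2 f L = val2 g L.
Proof. by move=> fg; apply: eq_big_nat => i /andP[_ /fg->]. Qed.

Lemma val2S f L : val2 f L.+1 = f 0 + 2 * val2 (fun i => f i.+1) L.
Proof.
rewrite /val2 big_nat_recl // muln1 big_distrr /=; congr (_ + _).
by apply: eq_bigr => i _; rewrite expnS mulnCA.
Qed.

Lemma val2_lt f L : val2 f L < 2 ^ L.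
Proof.
elim: L f => [|L IH] f; first by rewrite /val2 big_geq.
by rewrite val2S expnS; have := IH (fun i => f i.+1); case: (f 0); lia.
Qed.

Lemma bitS n i : bit n i.+1 = bit n./2 i.
Proof. by rewrite /bit expnS divnMA divn2. Qed.

Lemma bit_val2 f L i : bit (val2 f L) i = (i < L) && f i.
Proof.
elim: L f i => [|L IH] f i; first by rewrite /val2 big_geq // /bit div0n.
rewrite val2S mul2n; case: i => [|i].
  by rewrite /bit divn1 oddD odd_double addbF; case: (f 0).
by rewrite bitS half_bit_double IH.
Qed.

Lemma val2_bit n L : n < 2 ^ L -> val2 (bit n) L = n.
Proof.
elim: L n => [|L IH] n; first by rewrite /val2 big_geq //; case: n.
rewrite expnS => nL; rewrite val2S.
rewrite (@eq_val2 _ (bit n./2)) => [|i _]; last exact: bitS.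
by rewrite IH; [rewrite mul2n /bit divn1 odd_double_half|lia].
Qed.

(** Bijective numeration is binary notation in disguise: one more than the code has the string as
    its binary digits, below a leading 1. Hence [decode] reads the digits of n + 1 under the leading
    one. *)
Lemma code_mkseq f L : (code (mkseq f L)).+1 = val2 f L + 2 ^ L.
Proof.
elim: L f => [|L IH] f; first by rewrite /val2 big_geq.
rewrite /mkseq /= (iotaDl 1 0) -map_comp /= val2S expnS.
have := IH (fun i => f i.+1); rewrite /mkseq.
by rewrite (@eq_map _ _ (f \o addn 1) (fun i => f i.+1)) //; lia.
Qed.

Definition decode (n : nat) : seq bool := mkseq (bit n.+1) (trunc_log 2 n.+1).

Lemma decodeK : cancel decode code.
Proof.
move=> n; apply: succn_inj; rewrite code_mkseq.
have /andP[l1 l2] := trunc_log_bounds (isT : 1 < 2) (isT : 0 < n.+1).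
set L := trunc_log 2 n.+1 in l1 l2 *; rewrite -[in RHS](subnK l1); congr (_ + _).
rewrite -[RHS](@val2_bit _ L); last by move: l2; rewrite expnS; lia.
apply: eq_val2 => i iL; rewrite /bit -{1}(subnK l1) -(subnK (ltnW iL)) expnD.
rewrite addnC divnMDl ?expn_gt0 // oddD oddX /=.
by rewrite subn_eq0 leqNgt iL.
Qed.

Lemma code_inj : injective code.
Proof.
elim=> [|b s IH] [|c t] //=; [by lia|by lia|move=> E].
have bc : b = c by move: (f_equal odd E); rewrite !oddD !odd_double; case: b c {E} => -[].
by rewrite bc in E *; congr (_ :: _); apply: IH; lia.
Qed.

Lemma codeK : cancel code decode.
Proof. by move=> s; apply: code_inj; rewrite decodeK. Qed.

Lemma comp_bit m a b : computable m a -> computable m b -> computable m (fun v => bit (a v) (b v) : nat).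
Proof.
move=> Ha Hb; apply/comp_odd/comp_divn => //.
by apply: comp_expn => //; apply: comp_const.
Qed.

Lemma comp_val2 m (f : nat -> seq nat -> bool) a :
  computable m.+1 (fun w => f (nth 0 w 0) (behead w) : nat) -> computable m a ->
  computable m (fun v => val2 (f^~ v) (a v)).
Proof.
move=> Hf Ha; apply: (@comp_sum _ (fun i v => f i v * 2 ^ i)) => //.
apply: comp_muln => //; apply: comp_expn; [exact: comp_const|exact: comp_nth].
Qed.

Lemma comp_mkseq m (f : nat -> seq nat -> bool) a :
  computable m.+1 (fun w => f (nth 0 w 0) (behead w) : nat) -> computable m a ->
  computable m (fun v => code (mkseq (f^~ v) (a v))).
Proof.
move=> Hf Ha; apply: (@comp_ext _ (fun v => (val2 (f^~ v) (a v) + 2 ^ a v).-1)).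
  by move=> v _; rewrite -code_mkseq.
apply/comp_predn/comp_addn; first exact: comp_val2.
by apply: comp_expn => //; apply: comp_const.
Qed.

Lemma comp_size m a : computable m a -> computable m (fun v => size (decode (a v))).
Proof.
apply: (@comp_fun1 _ (fun x => size (decode x))).
(* A string of length L has a code n with 2^L <= n + 1 < 2^(L+1), so its length counts the positive
   exponents whose power of 2 is at most n + 1. *)
apply: (@comp_ext _ (fun v => \sum_(0 <= i < nth 0 v 0) (2 ^ i.+1 <= (nth 0 v 0).+1))).
  move=> v _; rewrite size_mkseq (sum_bool_count (fun i => _ <= _)).
  move: (nth 0 v 0) => n; rewrite -size_filter; set s := filter _ _.
  have -> : s = iota 0 (trunc_log 2 n.+1).
    apply: (@irr_sorted_eq _ ltn); rewrite ?iota_ltn_sorted //.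
    - exact: ltn_trans.
    - exact: ltnn.
    - by apply: sorted_filter; [exact: ltn_trans|exact: iota_ltn_sorted].
    move=> i; rewrite mem_filter !mem_iota /= add0n andbC.
    have [h|h] := leqP (2 ^ i.+1) n.+1.
      by have := trunc_log_max (isT : 1 < 2) h; have := ltn_expl i.+1 (isT : 1 < 2); lia.
    have := trunc_logP (isT : 1 < 2) (isT : 0 < n.+1).
    case: (leqP i.+1 (trunc_log 2 n.+1)) => // /(leq_pexp2l (isT : 0 < 2)); lia.
  by rewrite size_iota.
apply: comp_sum; last exact: comp_nth.
apply: comp_leq; last exact/comp_S/comp_nthb.
by apply: comp_expn; [exact: comp_const|exact/comp_S/comp_nth].
Qed.

Lemma comp_nthd m a b : computable m a -> computable m b ->
  computable m (fun v => nth false (decode (a v)) (b v) : nat).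
Proof.
move=> Ha Hb.
apply: (@comp_ext _ (fun v => (b v < size (decode (a v))) && bit (a v).+1 (b v) : nat)).
  move=> v _; case: ltnP => h /=; last by rewrite nth_default.
  by rewrite nth_mkseq //; move: h; rewrite size_mkseq.
apply: comp_and; first by apply: comp_leq; [exact: comp_S|exact: comp_size].
by apply: comp_bit => //; apply: comp_S.
Qed.

(* [y.+1] stands for the value [y], and [0] for no value within the bound [t] on
   the range of every unbounded search. *)
Fixpoint evalb (f : recfun) (t : nat) (v : seq nat) : nat :=
  match f with
  | Zero => 1
  | Succ => (nth 0 v 0).+2
  | Proj i => (nth 0 v i).+1
  | Comp f gs =>
      let ws := [seq evalb g t v | g <- gs] in
      if all (leq 1) ws then evalb f t [seq w.-1 | w <- ws] else 0
  | Prec f g =>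
      if v is n :: v' then
        (fix rec n := if n is n'.+1 then
           if 0 < rec n' then evalb g t [:: n', (rec n').-1 & v'] else 0
         else evalb f t v') n
      else evalb f t [::]
  | Mu f =>
      let n := find (fun n => evalb f t (n :: v) <= 1) (iota 0 t) in
      if (n < t) && (evalb f t (n :: v) == 1) then n.+1 else 0
  end.

(** * Step-bounded evaluation and prefix-free machines *)

(** [Comp] nests terms in a list, so the hypothesis for its entries comes from an inner induction on
    that list. *)
Lemma recfun_nested_ind (P : recfun -> Prop) :
  P Zero -> P Succ -> (forall i, P (Proj i)) ->
  (forall f gs, P f -> (forall i, i < size gs -> P (nth Zero gs i)) -> P (Comp f gs)) ->
  (forall f g, P f -> P g -> P (Prec f g)) ->
  (forall f, P f -> P (Mu f)) ->
  forall f, P f.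
Proof.
move=> PZ PS PP PC PR PM; fix IH 1; case=> [||i|f gs|f g|f]; [done|done|done|..].
- apply: PC; first exact: IH.
  (* [clear IH] prevents the empty case from being closed by a recursive call that is not
     structurally smaller. *)
  elim: gs => [i Hi|g gs IHgs [_|i Hi]]; [by clear IH|exact: (IH g)|exact: IHgs].
- exact: PR (IH f) (IH g).
- exact: PM (IH f).
Qed.

Lemma find_iota (p : pred nat) t n :
  n < t -> p n -> (forall i, i < n -> ~~ p i) -> find p (iota 0 t) = n.
Proof.
move=> nt pn np; have hp : has p (iota 0 t).
  by apply/hasP; exists n; rewrite ?mem_iota.
have := nth_find 0 hp; rewrite has_find size_iota in hp.
rewrite nth_iota // add0n => pf.
case: (ltngtP (find p (iota 0 t)) n) => // h.
  by have := np _ h; rewrite pf.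
by have := before_find 0 h; rewrite nth_iota ?add0n ?pn.
Qed.

Lemma find_iotaP (p : pred nat) t :
  let n := find p (iota 0 t) in
  n < t -> p n /\ forall i, i < n -> ~~ p i.
Proof.
move=> n nt; have hp : has p (iota 0 t) by rewrite has_find size_iota.
split=> [|i iN]; first by have := nth_find 0 hp; rewrite nth_iota.
by have /negbT := before_find 0 iN; rewrite nth_iota ?add0n //; apply: ltn_trans nt.
Qed.

Lemma evalb_sound f t v y : evalb f t v = y.+1 -> eval f v y.
Proof.
elim/recfun_nested_ind: f v y => [||i|f gs IHf IHgs|f g IHf IHg|f IHf] v y /=.
- by case=> <-; apply: eval_Zero.
- by case=> <-; apply: eval_Succ.
- by case=> <-; apply: eval_Proj.
- case: ifP => // /all_nthP H /IHf E.
  apply: (@eval_Comp _ _ _ _ _ _ _ E); rewrite ?size_map // => i Hi.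
  apply: IHgs => //; move/(_ 0 i): H; rewrite size_map => /(_ Hi).
  rewrite (nth_map 0) ?size_map // (nth_map Zero) //.
  by case: (evalb _ _ _).
- case: v => [|n v]; first by move/IHf; apply: eval_Prec_nil.
  elim: n y => [|n IHn] y; first by move/IHf; apply: eval_Prec_0.
  case: ifP => // r0 /IHg; apply: eval_Prec_S; apply: IHn.
  by rewrite prednK.
- set n := find _ _; case: ifP => // /andP[nt /eqP e1] [<-].
  have [_ H] := find_iotaP nt.
  apply: (@eval_Mu _ _ _ (fun i => (evalb f t (i :: v)).-2)); first exact: IHf.
  by move=> i /H; rewrite -/n => ?; apply: IHf; lia.
Qed.

(** The delicate case is [Mu]: the search stops at the first argument giving 0 or no value, so a
    success means a genuine 0 preceded by genuine positive values, and all of these persist under a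
    larger bound. *)
Lemma evalb_mono f t t' v y : t <= t' -> evalb f t v = y.+1 -> evalb f t' v = y.+1.
Proof.
move=> tt'; elim/recfun_nested_ind: f v y => [||i|f gs IHf IHgs|f g IHf IHg|f IHf] v y //=.
- case: ifP => // /all_nthP H.
  suff <- : [seq evalb g t v | g <- gs] = [seq evalb g t' v | g <- gs].
    by move/IHf => ->; rewrite ifT //; apply/(all_nthP 0) => i; apply: H.
  apply: (@eq_from_nth _ 0); rewrite ?size_map // => i Hi.
  move/(_ 0 i): H; rewrite size_map => /(_ Hi).
  rewrite !(nth_map Zero) //; case E: (evalb _ _ _) => [//|x] _.
  by rewrite (IHgs _ Hi _ _ E).
- case: v => [|n v]; first exact: IHf.
  elim: n y => [|n IHn] y; first exact: IHf.
  case: ifP => // r0; rewrite (IHn _ (esym (prednK r0))) /=; exact: IHg.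
- set n := find _ (iota 0 t); case: ifP => // /andP[nt /eqP e1] [<-].
  have [_ H] := find_iotaP nt.
  suff -> : find (fun n => evalb f t' (n :: v) <= 1) (iota 0 t') = n.
    by rewrite (IHf _ _ e1) (leq_trans nt).
  apply: find_iota; first exact: leq_trans nt tt'.
    by rewrite (IHf _ _ e1).
  move=> i /H; rewrite -ltnNge; case E: (evalb _ _ _) => [|[|x]] // _.
  by rewrite (IHf _ _ E).
Qed.

Lemma uniform_bound (n : nat) (Q : nat -> nat -> Prop) :
  (forall i t t', t <= t' -> Q i t -> Q i t') ->
  (forall i, i < n -> exists t, Q i t) -> exists t, forall i, i < n -> Q i t.
Proof.
move=> mono; elim: n => [|n IH] H; first by exists 0.
have [|t1 H1] := IH; first by move=> i /ltnW; apply: H.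
have [t2 H2] := H n (ltnSn n); exists (maxn t1 t2) => i.
rewrite ltnS leq_eqVlt => /orP[/eqP->|/H1].
  by apply: mono H2; rewrite leq_maxr.
by apply: mono; rewrite leq_maxl.
Qed.

Lemma evalb_complete f v y : eval f v y -> exists t, evalb f t v = y.+1.
Proof.
elim=> {f v y} [v|v|i v|f gs v ws y sw _ IH _ [t2 H2]|f g y _ [t H]|f g v y _ [t H]
  |f g n v r y _ [t1 H1] _ [t2 H2]|f v n r _ [t1 H1] _ IH]; try by exists 0.
- have [|t1 H1] := @uniform_bound (size gs) (fun i t => evalb (nth Zero gs i) t v = (nth 0 ws i).+1) _ IH.
    by move=> i t t'; apply: evalb_mono.
  exists (maxn t1 t2) => /=.
  have -> : [seq evalb g (maxn t1 t2) v | g <- gs] = [seq w.+1 | w <- ws].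
    apply: (@eq_from_nth _ 0); rewrite !size_map // => i Hi.
    rewrite (nth_map Zero) // (nth_map 0) ?sw //.
    by apply: evalb_mono (H1 i Hi); rewrite leq_maxl.
  rewrite all_map (eq_all (a2 := predT)) // all_predT -map_comp map_id.
  by apply: evalb_mono H2; rewrite leq_maxr.
- by exists t.
- by exists t.
- exists (maxn t1 t2); have := evalb_mono (leq_maxl t1 t2) H1 => /= ->.
  exact: evalb_mono (leq_maxr t1 t2) H2.
- have [|t2 H2] := @uniform_bound n (fun i t => evalb f t (i :: v) = (r i).+2) _ IH.
    by move=> i t t'; apply: evalb_mono.
  (* The search runs over arguments below [t], so [t] must exceed the least zero [n] itself. *)
  pose t := maxn n.+1 (maxn t1 t2).
  have t1t : t1 <= t by lia.
  have t2t : t2 <= t by lia.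
  exists t => /=; rewrite (@find_iota _ t n); first 1 last.
  - by lia.
  - by rewrite (evalb_mono t1t H1).
  - by move=> i /H2 /(evalb_mono t2t) ->.
  by rewrite (evalb_mono t1t H1) eqxx andbT (_ : n < t) //; lia.
Qed.

Lemma eval_det f v y y' : eval f v y -> eval f v y' -> y = y'.
Proof.
move=> /evalb_complete[t H] /evalb_complete[t' H'].
have := evalb_mono (leq_maxl t t') H; rewrite (evalb_mono (leq_maxr t t') H').
by case.
Qed.

Lemma comp_all_seq m (P : recfun -> seq nat -> bool) gs :
  (forall i, i < size gs -> computable m (fun w => P (nth Zero gs i) w : nat)) ->
  computable m (fun w => all (P^~ w) gs : nat).
Proof.
elim: gs => [|g gs IH] H /=; first exact: comp_const.
by apply: comp_and; [apply: (H 0)|apply: IH => i; apply: (H i.+1)].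
Qed.

Lemma comp_evalb_app f m a (Gs : seq (seq nat -> nat)) :
  computable (size Gs).+1 (fun w => evalb f (nth 0 w 0) (behead w)) -> computable m a ->
  (forall i, i < size Gs -> computable m (nth (fun=> 0) Gs i)) ->
  computable m (fun w => evalb f (a w) [seq G w | G <- Gs]).
Proof.
move=> Hf Ha HG; apply: (@comp_compose _ _ (a :: Gs) Hf) => -[|i] //.
exact: HG.
Qed.

(** The term [f] is fixed, so induction on it builds a term for its bounded evaluation, with the
    bound as first argument; terms themselves are never coded as numbers. *)
Lemma comp_evalb f m : computable m.+1 (fun w => evalb f (nth 0 w 0) (behead w)).
Proof.
pose tl k n := [seq (fun w => nth 0 w (k + i)) | i <- iota 0 n].
have stl k n : size (tl k n) = n by rewrite size_map size_iota.
elim/recfun_nested_ind: f m => [||i|f gs IHf IHgs|f g IHf IHg|f IHf] m /=.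
- exact: comp_const.
- exact/comp_S/comp_S/comp_nthb.
- exact/comp_S/comp_nthb.
- apply: (@comp_ext _ (fun w =>
    if all (fun g => 0 < evalb g (nth 0 w 0) (behead w)) gs then
    evalb f (nth 0 w 0) [seq G w | G <- [seq (fun w => (evalb g (nth 0 w 0) (behead w)).-1) | g <- gs]]
    else 0)).
    by move=> w _; rewrite all_map -!map_comp.
  apply: comp_if; last exact: comp_const.
    apply: comp_all_seq => i Hi; apply: comp_leq; first exact: comp_const.
    exact: IHgs.
  apply: comp_evalb_app; rewrite ?size_map //; first exact: comp_nth.
  by move=> i Hi; rewrite (nth_map Zero) //; apply/comp_predn/IHgs.
- case: m => [|m].
    by apply: comp_ext (IHf 0) => -[|t []].
  pose fix F n w {struct n} := if n is n'.+1 then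
      if 0 < F n' w then evalb g (nth 0 w 0) [:: n', (F n' w).-1 & drop 2 w] else 0
    else evalb f (nth 0 w 0) (drop 2 w).
  apply: (@comp_ext _ (fun w => F (nth 0 w 1) w)) => [[|t [|n v]] // _|].
    rewrite /=; elim: {1 3}n => [|k IH]; first by rewrite /= drop0.
    by rewrite [LHS]/= IH /= drop0.
  (* Index and accumulator are put in front of the list, which moves the bound to place 2 and the
     parameters to place 4. *)
  apply: (@comp_rec _ F (fun w => evalb f (nth 0 w 0) (drop 2 w))
    (fun u => if 0 < nth 0 u 1 then evalb g (nth 0 u 2)
       [:: nth 0 u 0, (nth 0 u 1).-1 & drop 4 u] else 0)) => //.
  + apply: (@comp_ext _ (fun w => evalb f (nth 0 w 0) [seq G w | G <- tl 2 m])).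
      by move=> w sw; rewrite (@drop_map_nth 2 m).
    apply: comp_evalb_app; rewrite ?stl //; first exact: comp_nth.
    by move=> i _; apply: comp_nth_seq.
  + apply: comp_if; last exact: comp_const.
      by apply: comp_leq; [exact: comp_const|exact: comp_nth].
    apply: (@comp_ext _ (fun w => evalb g (nth 0 w 2) [seq G w | G <-
      [:: (fun w => nth 0 w 0), (fun w => (nth 0 w 1).-1) & tl 4 m]])).
      by move=> w sw; rewrite (@drop_map_nth 4 m).
    apply: comp_evalb_app; rewrite /= ?stl //; first exact: comp_nth.
    move=> [|[|i]] _ /=; [exact: comp_nth|exact/comp_predn/comp_nth|exact: comp_nth_seq].
  + exact: comp_nth.
- pose p n (w : seq nat) := evalb f (nth 0 w 0) (n :: behead w) <= 1.
  have Hp n a k : computable n.+1 a -> computable n.+1 k -> (forall i, computable n.+1 (nth (fun=> 0) (tl 1 m) i)) ->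
      n = m -> computable n.+1 (fun w => evalb f (a w) (k w :: behead w)).
    move=> Ha Hk Ht nm; apply: (@comp_ext _ (fun w => evalb f (a w) [seq G w | G <- k :: tl 1 m])).
      by move=> w sw; rewrite -drop1 (@drop_map_nth 1 m) // sw nm.
    by apply: comp_evalb_app; rewrite /= ?stl // => -[|i] _ /=.
  have Hfind : computable m.+1 (fun w => find (p^~ w) (iota 0 (nth 0 w 0))).
    apply: comp_find; last exact: comp_nth.
    apply: comp_leq; last exact: comp_const.
    apply: (@comp_ext _ (fun w => evalb f (nth 0 w 1)
      [seq G w | G <- (fun w => nth 0 w 0) :: tl 2 m])).
      case=> // x w [sw]; rewrite nth_behead behead2.
      by rewrite (@drop_map_nth 2 m) //= sw.
    apply: comp_evalb_app; rewrite /= ?stl //; first exact: comp_nth.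
    by move=> [|i] _ /=; [exact: comp_nth|exact: comp_nth_seq].
  apply: comp_if; last exact: comp_const; last exact: comp_S.
  apply: comp_and; first by apply: comp_leq; [exact: comp_S|exact: comp_nth].
  apply: comp_eqn; last exact: comp_const.
  by apply: Hp => //; [exact: comp_nth|move=> i; exact: comp_nth_seq].
Qed.

(** Turns a decidable test into a partial recursive function: [Mu] runs on the negation of [T],
    since it looks for a zero. For the converse, inverting an evaluation shows that the search has
    halted, and determinism fixes the output. *)
Lemma min_search_eval m (T : seq nat -> bool) out :
  computable m.+1 (fun w => T w : nat) -> computable m.+1 out ->
  exists f, forall v y, size v = m -> eval f v y <->
    exists t, [/\ T (t :: v), forall i, i < t -> ~~ T (i :: v) & y = out (t :: v)].
Proof.
move=> /comp_neg[fT HT] [fo Ho].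
pose f := Comp fo (Mu fT :: [seq Proj i | i <- iota 0 m]).
have fwd v t : size v = m -> T (t :: v) -> (forall i, i < t -> ~~ T (i :: v)) ->
    eval f v (out (t :: v)).
  move=> sv Tt Tmin; apply: (@eval_Comp _ _ _ (t :: v)).
  - by rewrite /= size_map size_iota sv.
  - case=> [_|i]; last first.
      rewrite /= size_map size_iota ltnS => im.
      by rewrite (nth_map 0) ?size_iota // nth_iota //; apply: eval_Proj.
    apply: (@eval_Mu _ _ _ (fun=> 0)).
      by have := HT (t :: v); rewrite Tt; apply; rewrite /= sv.
    by move=> i /Tmin Ti; have := HT (i :: v); rewrite Ti; apply; rewrite /= sv.
  - by apply: Ho; rewrite /= sv.
exists f => v y sv; split=> [E|[t [Tt Tmin ->]]]; last exact: fwd.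
have [n En] : exists n, eval (Mu fT) v n.
  by inversion E as [| | |? ? ? ws ? _ Hgs _ | | | |]; subst; exists (nth 0 ws 0); apply: (Hgs 0).
have [Tn Tmin] : T (n :: v) /\ forall i, i < n -> ~~ T (i :: v).
  inversion En as [| | | | | | |? ? ? r H0 Hlt]; subst; split.
    by have := eval_det H0 (HT (n :: v) (erefl _)); case: (T _).
  by move=> i /Hlt H; have := eval_det H (HT (i :: v) (erefl _)); case: (T _).
by exists n; split=> //; apply: eval_det E (fwd _ _ sv Tn Tmin).
Qed.

(** * Machines reading a program followed by advice *)

Lemma comp_take m a i : computable m a -> computable m i ->
  computable m (fun v => code (take (i v) (decode (a v)))).
Proof.
apply: (@comp_fun2 _ (fun x y => code (take y (decode x)))).
apply: (@comp_ext _ (fun v => code (mkseq (fun j => nth false (decode (nth 0 v 0)) j)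
  (nth 0 v 1 - (nth 0 v 1 - size (decode (nth 0 v 0))))))).
  move=> v _; congr code; move: (decode _) (nth 0 v 1) => s n.
  apply: (@eq_from_nth _ false); rewrite size_mkseq ?size_take; first by case: ltnP; lia.
  by move=> j Hj; rewrite nth_mkseq // nth_take //; lia.
apply: (@comp_mkseq _ (fun j v => nth false (decode (nth 0 v 0)) j)).
  by apply: comp_nthd; [exact: comp_nthb|exact: comp_nth].
apply: comp_subn; first exact: comp_nth.
by apply: comp_subn; [exact: comp_nth|apply/comp_size/comp_nth].
Qed.

Lemma comp_drop m a i : computable m a -> computable m i ->
  computable m (fun v => code (drop (i v) (decode (a v)))).
Proof.
apply: (@comp_fun2 _ (fun x y => code (drop y (decode x)))).
apply: (@comp_ext _ (fun v => code (mkseq (fun j => nth false (decode (nth 0 v 0)) (nth 0 v 1 + j))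
  (size (decode (nth 0 v 0)) - nth 0 v 1)))).
  move=> v _; congr code; move: (decode _) (nth 0 v 1) => s n.
  apply: (@eq_from_nth _ false); rewrite size_mkseq ?size_drop //.
  by move=> j Hj; rewrite nth_mkseq // nth_drop.
apply: (@comp_mkseq _ (fun j v => nth false (decode (nth 0 v 0)) (nth 0 v 1 + j))).
  by apply: comp_nthd; [exact: comp_nthb|apply: comp_addn; [exact: comp_nthb|exact: comp_nth]].
by apply: comp_subn; [apply/comp_size/comp_nth|exact: comp_nth].
Qed.

Lemma prefix_total (T : eqType) (a b s : seq T) :
  prefix a s -> prefix b s -> size a <= size b -> prefix a b.
Proof.
rewrite !prefixE => /eqP Ha /eqP Hb ab.
by rewrite -Hb take_takel // Ha.
Qed.

Lemma prefix_cat2 (T : eqType) (a b c : seq T) : prefix (a ++ b) (a ++ c) -> prefix b c.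
Proof. by elim: a => //= x a IH; rewrite eqxx. Qed.

(** The input is a program [p] of [U] for some [s], followed by advice [q] from a set depending on
    [s]. Since [U] is prefix-free, [p] is determined by the input, hence so is [s], and then
    prefix-freeness of the advice for this [s] applies. *)
Lemma extension_machine (U : machine) (dom : seq bool -> seq bool -> bool)
    (Phi : seq bool -> seq bool -> seq bool) :
  prefix_free_machine U ->
  computable 2 (fun v => dom (decode (nth 0 v 0)) (decode (nth 0 v 1)) : nat) ->
  computable 2 (fun v => code (Phi (decode (nth 0 v 0)) (decode (nth 0 v 1)))) ->
  (forall s q q', dom s q -> dom s q' -> prefix q q' -> q = q') ->
  exists2 M, prefix_free_machine M &
    forall p s q, U p = Some s -> dom s q -> M (p ++ q) = Some (Phi s q).
Proof.
move=> [[fU HU] pfU] Hdom HPhi pfdom.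
pose rel r y := exists p s q, [/\ r = p ++ q, U p = Some s, dom s q & y = Phi s q].
(* [M] is defined from its graph without regard to effectiveness; the search for a splitting point
   below shows it computable. *)
pose M r := if pselect (exists y, rel r y) is left h then Some (projT1 (cid h)) else None.
have uniq p q p' q' s s' : U p = Some s -> U p' = Some s' -> dom s q -> dom s' q' ->
    prefix (p ++ q) (p' ++ q') -> [/\ p = p', q = q' & s = s'].
  move=> Up Up' dq dq' pre.
  have pp : prefix p (p' ++ q') := prefix_trans (prefix_prefix p q) pre.
  have pp' : p = p'.
    have [le|/ltnW le] := leqP (size p) (size p').
      by apply: pfU; rewrite ?Up ?Up' //; apply: prefix_total pp (prefix_prefix p' q') le.
    by symmetry; apply: pfU; rewrite ?Up ?Up' //; apply: prefix_total (prefix_prefix p' q') pp le.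
  subst p'; move: Up'; rewrite Up => -[ss']; subst s'; split=> //.
  exact: pfdom dq dq' (prefix_cat2 pre).
have rel_fun r y y' : rel r y -> rel r y' -> y = y'.
  move=> [p [s [q [-> Up dq ->]]]] [p' [s' [q' [E Up' dq' ->]]]].
  have [|_ -> ->] // := uniq _ _ _ _ _ _ Up Up' dq dq'.
  by rewrite E prefix_refl.
have MP r y : M r = Some y <-> rel r y.
  rewrite /M; case: pselect => [h|h]; last by split=> // ry; case: h; exists y.
  case: cid => y' ry' /=; split=> [[<-] //|ry].
  by rewrite (rel_fun _ _ _ ry ry').
exists M; last by move=> p s q Up dq; apply/MP; exists p, s, q.
split; last first.
  move=> r r'; case E: (M r) => [y|] // _; case E': (M r') => [y'|] // _.
  move/MP: E => [p [s [q [-> Up dq _]]]]; move/MP: E' => [p' [s' [q' [-> Up' dq' _]]]].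
  by move=> /(uniq _ _ _ _ _ _ Up Up' dq dq')[-> -> _].
(* Here [w] lists a bound and the code of the input: [E i w] evaluates [U] within the bound on the
   first [i] bits, and [A i w] accepts the splitting point [i]. The search is for a bound at which
   some point is accepted. *)
pose E i (w : seq nat) := evalb fU (nth 0 w 0) [:: code (take i (decode (nth 0 w 1)))].
pose rest i (w : seq nat) := code (drop i (decode (nth 0 w 1))).
pose A i w := (0 < E i w) && dom (decode (E i w).-1) (decode (rest i w)).
pose len (w : seq nat) := (size (decode (nth 0 w 1))).+1.
pose pos w := find (A^~ w) (iota 0 (len w)).
pose out w := code (Phi (decode (E (pos w) w).-1) (decode (rest (pos w) w))).
have compE : computable 3 (fun w => E (nth 0 w 0) (behead w)).
  apply: (@comp_evalb_app _ _ _ [:: _]) => [|| [|//] _ /=].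
  - exact: comp_evalb.
  - exact: comp_nthb.
  - by apply: comp_take; [exact: comp_nthb|exact: comp_nth].
have comprest : computable 3 (fun w => rest (nth 0 w 0) (behead w)).
  by apply: comp_drop; [exact: comp_nthb|exact: comp_nth].
have compA : computable 3 (fun w => A (nth 0 w 0) (behead w) : nat).
  apply: comp_and; first by apply: comp_leq => //; exact: comp_const.
  exact: (@comp_fun2 _ (fun x y => dom (decode x) (decode y) : nat) _ _ Hdom
    (comp_predn compE) comprest).
have complen : computable 2 len by apply/comp_S/comp_size/comp_nth.
have comppos : computable 2 pos by apply: comp_find.
have compout : computable 2 out.
  apply: (@comp_cons _ (fun w => code (Phi (decode (E (nth 0 w 0) (behead w)).-1)
    (decode (rest (nth 0 w 0) (behead w))))) _ _ comppos).
  exact: (@comp_fun2 _ (fun x y => code (Phi (decode x) (decode y))) _ _ HPhi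
    (comp_predn compE) comprest).
have [f Hf] := min_search_eval (comp_has compA complen) compout.
have AP i t r : A i [:: t; code r] ->
    rel r (Phi (decode (E i [:: t; code r]).-1) (decode (rest i [:: t; code r]))).
  rewrite /A /rest /E /= !codeK => /andP[].
  case e: (evalb _ _ _) => [//|x] _ dx; exists (take i r), (decode x), (drop i r).
  split=> //; first by rewrite cat_take_drop.
  by apply/HU; rewrite decodeK; apply: evalb_sound e.
exists f => r y; rewrite MP Hf //; split=> [ry|[t [Tt _ yE]]]; last first.
  move: Tt yE; rewrite has_find size_iota => Tt.
  have [/AP ry _] := find_iotaP Tt.
  by rewrite /out => /code_inj ->.
have [t Tt] : exists t, has (A^~ [:: t; code r]) (iota 0 (len [:: t; code r])).
  have [p [s [q [rE Up dq yE]]]] := ry; move/HU/evalb_complete: Up => [t Ht]; exists t.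
  apply/hasP; exists (size p); first by rewrite mem_iota /len /= codeK rE size_cat; lia.
  by rewrite /A /E /rest /= !codeK rE take_size_cat // drop_size_cat // Ht /= codeK dq.
have [t0 Tt0 min0] := ex_minnP (P := fun t => has (A^~ [:: t; code r]) (iota 0 (len [:: t; code r]))) (ex_intro _ t Tt).
exists t0; split=> //.
  by move=> i it0; apply/negP => /min0; lia.
move: Tt0; rewrite has_find size_iota => Tt0.
have [/AP ry' _] := find_iotaP Tt0.
by rewrite (rel_fun _ _ _ ry ry').
Qed.

(** * Prefix-free complexity *)

(** A machine defined on the empty program only, with value [s], is prefix-free, so optimality gives
    [s] a program of [U]. *)
Lemma optimal_surj U s : optimal U -> exists p, U p = Some s.
Proof.
move=> [_ opt]; pose M : machine := fun p => if p is [::] then Some s else None.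
case: (opt M) => [|c /(_ [::] s erefl)[q Uq _]]; last by exists q.
split; last by move=> [|? ?] [|? ?].
(* The test asks whether the input has code 0, that is, is empty. It ignores the search variable, so
   the search stops at once or never. *)
have [f Hf] : exists f, forall v y, size v = 1 -> eval f v y <->
    exists t, [/\ nth 0 v 0 == 0, forall i, i < t -> nth 0 v 0 != 0 & y = code s].
  apply: (@min_search_eval _ (fun w => nth 0 (behead w) 0 == 0) (fun=> code s)).
    exact/comp_eq0/comp_nthb.
  exact: comp_const.
exists f => p y; rewrite Hf //=; case: p => [|b p] /=; last first.
  by split=> // -[t [/eqP]]; case: b; lia.
split=> [[<-]|[t [_ _ /code_inj ->]]] //.
by exists 0.
Qed.

Lemma K_le U p s : U p = Some s -> K U s <= size p.
Proof.
move=> Up; rewrite /K; case: pselect => // h.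
by case: ex_minnP => n _; apply; apply/asboolP; exists p.
Qed.

Lemma K_attained U s : optimal U -> exists2 p, U p = Some s & size p = K U s.
Proof.
move=> /(optimal_surj s)[p Up]; rewrite /K; case: pselect => [h|[]].
  by case: ex_minnP => n /asboolP.
by exists (size p); apply/asboolP; exists p.
Qed.

(** Turns each decoder into a complexity bound: the advice costs its own length, and the constant
    serves all [s] and [q]. *)
Lemma K_extension U (dom : seq bool -> seq bool -> bool)
    (Phi : seq bool -> seq bool -> seq bool) : optimal U ->
  computable 2 (fun v => dom (decode (nth 0 v 0)) (decode (nth 0 v 1)) : nat) ->
  computable 2 (fun v => code (Phi (decode (nth 0 v 0)) (decode (nth 0 v 1)))) ->
  (forall s q q', dom s q -> dom s q' -> prefix q q' -> q = q') ->
  exists c, forall s q, dom s q -> K U (Phi s q) <= K U s + size q + c.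
Proof.
move=> optU Hdom HPhi pf; have [pfU opt] := optU.
have [M pfM HM] := extension_machine pfU Hdom HPhi pf.
have [c Hc] := opt M pfM; exists c => s q dq.
have [p Up <-] := K_attained s optU.
have [r /K_le Kr Hr] := Hc _ _ (HM p s q Up dq).
by rewrite size_cat in Hr; lia.
Qed.

Definition compressible U s := K U s < size s.

(* Otherwise, replacing a compressible prefix by its program and padding with
   zeros would inject the strings of length [N.+1] into those of length [N]. *)
Lemma incompressible_prefixes U N : optimal U ->
  exists s, size s = N /\ forall n, n <= N -> ~~ compressible U (take n s).
Proof.
move=> optU; have [[_ pfU] _] := optU.
case: N => [|N]; first by exists [::]; split=> // n _; rewrite /compressible ltnNge.
case: (pselect (exists s, size s = N.+1 /\ forall n, n <= N.+1 -> ~~ compressible U (take n s))) => // nex.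
have bad (x : N.+1.-tuple bool) : exists np : nat * seq bool,
    [/\ np.1 <= N.+1, U np.2 = Some (take np.1 x) & size np.2 < np.1].
  case: (pselect (exists n, n <= N.+1 /\ compressible U (take n x))) => [[n [nN cn]]|ne].
    have [p Up sp] := K_attained (take n x) optU; exists (n, p); split=> //=.
    by move: cn; rewrite /compressible sp size_takel ?size_tuple.
  case: nex; exists x; rewrite size_tuple; split=> // n nN.
  by apply/negP => cn; apply: ne; exists n.
pose np x := projT1 (cid (bad x)).
have npP x : [/\ (np x).1 <= N.+1, U (np x).2 = Some (take (np x).1 x) & size (np x).2 < (np x).1].
  by rewrite /np; case: cid.
(* The program is shorter than the prefix it replaces, so the padding can be chosen to give total
   length exactly [N]. *)
pose img (x : N.+1.-tuple bool) := (np x).2 ++ drop (np x).1 x ++ nseq ((np x).1 - size (np x).2).-1 false.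
have simg x : size (img x) == N.
  have [h1 h2 h3] := npP x.
  by rewrite !size_cat size_nseq size_drop size_tuple; lia.
have inj : injective (fun x => Tuple (simg x)).
  move=> x y [E]; have [x1 x2 x3] := npP x; have [y1 y2 y3] := npP y.
  have px : prefix (np x).2 (img x) by apply: prefix_prefix.
  have py : prefix (np y).2 (img x) by rewrite E; apply: prefix_prefix.
  (* Prefix-freeness recovers the program from the image; its output is the compressed prefix, and
     the unpadded rest follows. *)
  have pp : (np x).2 = (np y).2.
    have [le|/ltnW le] := leqP (size (np x).2) (size (np y).2).
      by apply: pfU; rewrite ?x2 ?y2 //; apply: prefix_total px py le.
    by symmetry; apply: pfU; rewrite ?x2 ?y2 //; apply: prefix_total py px le.
  have tk : take (np x).1 x = take (np y).1 y by move: x2; rewrite pp y2 => -[].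
  have nn : (np x).1 = (np y).1 by move/(congr1 size): tk; rewrite !size_takel ?size_tuple.
  move: E => /eqP; rewrite /img pp eqseq_cat // eqxx /= nn eqseq_cat ?size_drop ?size_tuple // => /andP[/eqP dr _].
  by apply: val_inj; rewrite -[LHS](cat_take_drop (np y).1) -[RHS](cat_take_drop (np y).1) -dr -tk nn.
have := leq_card _ inj; rewrite !card_tuple card_bool expnS.
by have := expn_gt0 2 N; lia.
Qed.

(** Koenig's lemma on the tree of strings all of whose prefixes are incompressible: a string is live
    if it has arbitrarily long extensions in the tree, and a live string has a live child. *)
Lemma random_real U : optimal U -> exists r : real2, forall n, n <= K U (mkseq r n).
Proof.
move=> optU.
pose live s := forall N, exists x, [/\ size s + N <= size x, prefix s x &
  forall n, n <= size x -> ~~ compressible U (take n x)].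
have live0 : live [::].
  move=> N; have [x [sx Hx]] := incompressible_prefixes N optU.
  by exists x; rewrite sx add0n; split=> //; rewrite prefix0s.
have liveS s : live s -> exists b, live (rcons s b).
  move=> ls; apply: contrapT => nex.
  have dead b : exists N, ~ exists x, [/\ size (rcons s b) + N <= size x, prefix (rcons s b) x &
      forall n, n <= size x -> ~~ compressible U (take n x)].
    by apply/existsNP => h; apply: nex; exists b.
  have [N0 d0] := dead false; have [N1 d1] := dead true.
  (* If the children die within [N0] and [N1] further bits, an extension by N0 + N1 + 1 bits still
     passes through one of them and outlives it. *)
  have [x [sx /prefixP[y xE] Hx]] := ls (N0 + N1).+1.
  case: y xE => [|b y] xE; first by move: sx; rewrite xE cats0; lia.
  rewrite -cat_rcons in xE.
  by case: b xE => xE; [apply: d1|apply: d0]; exists x; split=> //;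
    rewrite ?size_rcons ?xE ?prefix_prefix //; rewrite -?xE; lia.
pose step s := if pselect (exists b, live (rcons s b)) is left h then projT1 (cid h) else false.
have stepP s : live s -> live (rcons s (step s)).
  by move=> /liveS h; rewrite /step; case: pselect => // h'; case: cid.
pose pre n := iter n (fun s => rcons s (step s)) [::].
have live_pre n : live (pre n) by elim: n => //= n; apply: stepP.
have size_pre n : size (pre n) = n by elim: n => //= n IH; rewrite size_rcons IH.
exists (fun n => step (pre n)) => n.
have -> : mkseq (fun n => step (pre n)) n = pre n.
  by elim: n => //= n IH; rewrite mkseqS IH.
have [x [sx px Hx]] := live_pre n 0.
rewrite addn0 size_pre in sx; have := Hx n sx.
move: px; rewrite prefixE size_pre => /eqP ->.
by rewrite /compressible size_pre -leqNgt.
Qed.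

(** * Blocks and the transformed real *)

(* A random window [k] contains 2^(k+1) blocks starting with 0^D 1 on average,
   while a position in it takes only 6(k+1)+5 bits, fewer than the 8(k+1)+1 bits
   of a block. *)
Definition depth k := 4 * k.+1.
Definition block_len k := (depth k).*2.+1.
Definition block_count k := 2 ^ (5 * k.+1).+1.
Definition win_len k := block_len k * block_count k.
Definition win_start k := \sum_(0 <= l < k) win_len l.
(** The window containing [n], as the number of windows ending at or before [n]; these all have
    index below [n], since k <= [win_start k]. *)
Definition win n := \sum_(0 <= k < n) (win_start k.+1 <= n).
Definition block_start n :=
  win_start (win n) + (n - win_start (win n)) %/ block_len (win n) * block_len (win n).

Lemma win_startS k : win_start k.+1 = win_start k + win_len k.
Proof. by rewrite /win_start big_nat_recr. Qed.

Lemma win_len_gt0 k : 0 < win_len k.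
Proof. by rewrite muln_gt0 expn_gt0. Qed.

Lemma win_start_ltn : {homo win_start : k l / k < l}.
Proof.
by apply: homo_ltn => [? ? ?|k]; [exact: ltn_trans|rewrite win_startS -[X in X < _]addn0 ltn_add2l win_len_gt0].
Qed.

Lemma win_start_leq : {homo win_start : k l / k <= l}.
Proof.
by move=> k l; rewrite leq_eqVlt => /orP[/eqP->|/win_start_ltn/ltnW].
Qed.

Lemma leq_win_start k : k <= win_start k.
Proof.
by elim: k => // k IH; have := win_start_ltn (ltnSn k); lia.
Qed.

Lemma win_eq k n : win_start k <= n < win_start k.+1 -> win n = k.
Proof.
move=> /andP[kn nk]; rewrite /win sum_bool_count.
rewrite (@eq_count _ _ (fun l => l < k)); last first.
  move=> l; apply/idP/idP => [ln|lk]; last by rewrite (leq_trans (win_start_leq lk)).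
  by rewrite ltnNge; apply/negP => kl; have := @win_start_leq k.+1 l.+1 kl; lia.
have -> : n = k + (n - k) by have := leq_win_start k; lia.
rewrite iotaD count_cat add0n (eq_in_count (a2 := predT)) => [|l]; last by rewrite mem_iota.
rewrite count_predT size_iota (eq_in_count (a2 := pred0)) ?count_pred0 ?addn0 // => l.
by rewrite mem_iota /=; lia.
Qed.

Lemma win_bounds n : win_start (win n) <= n < win_start (win n).+1.
Proof.
have [|k nk kmin] := ex_minnP (P := fun k => n < win_start k.+1).
  by exists n; apply: leq_win_start.
suff kn : win_start k <= n < win_start k.+1 by rewrite (win_eq kn).
rewrite nk andbT; case: k nk kmin => [|k] nk kmin; first by rewrite /win_start big_geq.
by rewrite leqNgt; apply/negP => /kmin; rewrite ltnn.
Qed.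

Lemma block_start_bounds n : block_start n <= n < block_start n + block_len (win n).
Proof.
have /andP[wn _] := win_bounds n; rewrite /block_start.
have := divn_eq (n - win_start (win n)) (block_len (win n)).
have := @ltn_pmod (n - win_start (win n)) (block_len (win n)) isT; lia.
Qed.

Lemma block_in_win n :
  win_start (win n) <= block_start n /\
  block_start n + block_len (win n) <= win_start (win n).+1.
Proof.
split; first by rewrite leq_addr.
have /andP[wn nw] := win_bounds n.
rewrite /block_start win_startS /win_len -addnA leq_add2l -mulSnr mulnC leq_pmul2l //.
by rewrite ltn_divLR // mulnC; move: nw; rewrite win_startS /win_len; lia.
Qed.

Lemma block_start_eq k j i : j < block_count k -> i < block_len k ->
  let n := win_start k + j * block_len k + i in
  win n = k /\ block_start n = win_start k + j * block_len k.
Proof.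
move=> jG iB n; have wn : win n = k.
  apply: win_eq; rewrite win_startS /win_len /n.
  have : j.+1 * block_len k <= block_count k * block_len k by rewrite leq_mul2r jG orbT.
  by rewrite mulSn; lia.
split=> //; rewrite /block_start wn /n -addnA addKn divnMDl //.
by rewrite divn_small // addn0.
Qed.

Lemma block_index n : exists2 j, j < block_count (win n) &
  block_start n = win_start (win n) + j * block_len (win n).
Proof.
exists ((n - win_start (win n)) %/ block_len (win n)) => //.
have /andP[wn nw] := win_bounds n.
by rewrite ltn_divLR // mulnC; move: nw; rewrite win_startS /win_len; lia.
Qed.

Lemma same_block n i : i < block_len (win n) ->
  win (block_start n + i) = win n /\ block_start (block_start n + i) = block_start n.
Proof.
by move=> iB; have [j jG ->] := block_index n; apply: block_start_eq.
Qed.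

Lemma prev_block i n : i < block_start n -> block_start i + block_len (win i) <= block_start n.
Proof.
move=> iN; rewrite leqNgt; apply/negP => h.
have /andP[l1 l2] := block_start_bounds i.
have [|_] := @same_block i (block_start n - block_start i); first by lia.
have [|_] := @same_block n 0; first by [].
by rewrite addn0 subnKC; lia.
Qed.

(** Place [l] of a cycle, i.e. 2^l times an odd number below 2^(D+1), in the form of an arithmetical
    test. *)
Definition layer D l d := (d %% 2 ^ l.+1 == 2 ^ l) && (d < 2 ^ (D + l).+1).

(** For numbers below 2^(2D+1) the first test singles out place D of a cycle ([layerD]), which
    returns to place 0; earlier places are doubled. *)
Definition phi D d :=
  if d %% 2 ^ D.+1 == 2 ^ D then d %/ 2 ^ D
  else if has (layer D ^~ d) (iota 0 D) then d.*2 else d.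

(** Runs through the cycles backwards: place 0 goes to place D, and places 1 to D are halved. *)
Definition psi D d :=
  if odd d && (d < 2 ^ D.+1) then d * 2 ^ D
  else if has (layer D ^~ d) (iota 1 D) then d./2 else d.

Lemma layerP D l d :
  reflect (exists o, [/\ odd o, o < 2 ^ D.+1 & d = 2 ^ l * o]) (layer D l d).
Proof.
have e0 : 0 < 2 ^ l by rewrite expn_gt0.
apply: (iffP andP) => [[/eqP dl ld]|[o [oo oD ->]]].
  have dE : d = 2 ^ l * (d %/ 2 ^ l.+1).*2.+1.
    by rewrite {1}(divn_eq d (2 ^ l.+1)) dl expnS; lia.
  exists (d %/ 2 ^ l.+1).*2.+1; split=> //; first by rewrite /= odd_double.
  by rewrite -(ltn_pmul2l e0) -dE -expnD addnS addnC.
split; last by rewrite -addSn expnD mulnC ltn_pmul2r.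
rewrite -[o]odd_double_half oo mulnDr muln1 -mul2n mulnA -expnSr mulnC addnC modnMDl.
by rewrite modn_small // ltn_exp2l.
Qed.

Lemma layer0 D d : layer D 0 d = odd d && (d < 2 ^ D.+1).
Proof. by rewrite /layer addn0 modn2 expn0; case: (odd d). Qed.

Lemma layerD D d : d < 2 ^ D.*2.+1 -> layer D D d = (d %% 2 ^ D.+1 == 2 ^ D).
Proof. by rewrite /layer addnn => ->; rewrite andbT. Qed.

Lemma psiK D d : d < 2 ^ D.*2.+1 -> psi D (phi D d) = d.
Proof.
move=> dB; rewrite /phi -layerD //; case: (boolP (layer D D d)) => [/layerP[o [oo oD ->]]|nD].
  by rewrite mulKn ?expn_gt0 // /psi oo oD mulnC.
case: hasP => [[l lD ld]|nex].
  have ld2 : layer D l.+1 d.*2.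
    by have /layerP[o [oo oD ->]] := ld; apply/layerP; exists o; split=> //; rewrite expnS -mul2n mulnA.
  rewrite /psi odd_double /=; case: hasP => [_|[]]; first by rewrite doubleK.
  by exists l.+1 => //; move: lD; rewrite !mem_iota; lia.
(* Here [d] occupies none of the places 0 to D, so both tests of [psi], for place 0 and for places 1
   to D, fail. *)
rewrite /psi -layer0; case: (boolP (layer D 0 d)) => [l0|_].
  case: D nD nex l0 {dB} => [|D] nD nex l0; first by rewrite l0 in nD.
  by case: nex; exists 0; rewrite ?mem_iota.
case: hasP => // -[l]; rewrite mem_iota => lD ld.
case: (eqVneq l D) => [lE|nlD]; first by rewrite lE in ld; rewrite ld in nD.
by case: nex; exists l; rewrite ?mem_iota //; lia.
Qed.

Lemma phi_lt D d : d < 2 ^ D.*2.+1 -> phi D d < 2 ^ D.*2.+1.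
Proof.
move=> dB; rewrite /phi; case: ifP => _; first exact: leq_ltn_trans (leq_div _ _) dB.
case: hasP => // -[l]; rewrite mem_iota add0n => /= lD /layerP[o [oo oD ->]].
rewrite -mul2n mulnA -expnS; apply: (@leq_trans (2 ^ l.+1 * 2 ^ D.+1)).
  by rewrite ltn_pmul2l ?expn_gt0.
by rewrite -expnD leq_exp2l //; lia.
Qed.

Definition digit (f : nat -> bool) k b := val2 (fun i => f (b + i)) (block_len k).

Definition transform (z : real2) : real2 := fun n =>
  bit (phi (depth (win n)) (digit z (win n) (block_start n))) (n - block_start n).

Lemma digit_transform z n :
  digit (transform z) (win n) (block_start n) =
  phi (depth (win n)) (digit z (win n) (block_start n)).
Proof.
rewrite -[RHS](@val2_bit _ (block_len (win n))); last exact/phi_lt/val2_lt.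
apply: eq_val2 => i iB; have [wE bE] := same_block iB.
by rewrite /transform wE bE addKn.
Qed.

(** * Computability of the decoders *)

Lemma comp_cat m a b : computable m a -> computable m b ->
  computable m (fun v => code (decode (a v) ++ decode (b v))).
Proof.
apply: (@comp_fun2 _ (fun x y => code (decode x ++ decode y))).
pose f i (v : seq nat) := if i < size (decode (nth 0 v 0)) then nth false (decode (nth 0 v 0)) i
  else nth false (decode (nth 0 v 1)) (i - size (decode (nth 0 v 0))).
apply: (@comp_ext _ (fun v => code (mkseq (f^~ v) (size (decode (nth 0 v 0)) + size (decode (nth 0 v 1)))))).
  move=> v _; congr code; apply: (@eq_from_nth _ false); rewrite size_mkseq ?size_cat // => i Hi.
  by rewrite nth_mkseq // nth_cat.
have cs n i : computable n (fun v => size (decode (nth 0 v i))) by apply/comp_size/comp_nth.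
have csb n i : computable n (fun v => size (decode (nth 0 (behead v) i))) by apply/comp_size/comp_nthb.
apply: comp_mkseq; last exact: comp_addn.
apply: comp_ifb; first by apply: comp_leq => //; apply/comp_S/comp_nth.
  by apply: comp_nthd; [exact: comp_nthb|exact: comp_nth].
apply: comp_nthd; first exact: comp_nthb.
by apply: comp_subn => //; exact: comp_nth.
Qed.

Lemma comp_code_cat m (f g : seq nat -> seq bool) :
  computable m (fun v => code (f v)) -> computable m (fun v => code (g v)) ->
  computable m (fun v => code (f v ++ g v)).
Proof.
by move=> Hf Hg; apply: comp_ext (comp_cat Hf Hg) => v _; rewrite !codeK.
Qed.

Lemma comp_code_decode m a : computable m a -> computable m (fun v => code (decode (a v))).
Proof. by apply: comp_ext => v _; rewrite decodeK. Qed.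

Lemma comp_double m a : computable m a -> computable m (fun v => (a v).*2).
Proof.
move=> Ha; apply: (@comp_ext _ (fun v => a v + a v)) => [v _|]; first by rewrite addnn.
exact: comp_addn.
Qed.

Lemma comp_half m a : computable m a -> computable m (fun v => (a v)./2).
Proof.
move=> Ha; apply: (@comp_ext _ (fun v => a v %/ 2)) => [v _|]; first by rewrite divn2.
by apply: comp_divn => //; exact: comp_const.
Qed.

Lemma comp_depth m a : computable m a -> computable m (fun v => depth (a v)).
Proof. by move=> Ha; apply: comp_muln; [exact: comp_const|exact: comp_S]. Qed.

Lemma comp_block_len m a : computable m a -> computable m (fun v => block_len (a v)).
Proof. by move=> Ha; apply/comp_S/comp_double/comp_depth. Qed.

Lemma comp_win_len m a : computable m a -> computable m (fun v => win_len (a v)).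
Proof.
move=> Ha; apply: comp_muln; first exact: comp_block_len.
apply: comp_expn; first exact: comp_const.
by apply/comp_S/comp_muln; [exact: comp_const|exact: comp_S].
Qed.

Lemma comp_win_start m a : computable m a -> computable m (fun v => win_start (a v)).
Proof.
apply: (@comp_fun1 _ win_start); apply: (@comp_sum _ (fun i _ => win_len i)).
  exact/comp_win_len/comp_nth.
exact: comp_nth.
Qed.

Lemma comp_win m a : computable m a -> computable m (fun v => win (a v)).
Proof.
apply: (@comp_fun1 _ win); apply: (@comp_sum _ (fun i v => win_start i.+1 <= nth 0 v 0)).
  by apply: comp_leq; [exact/comp_win_start/comp_S/comp_nth|exact: comp_nthb].
exact: comp_nth.
Qed.

Lemma comp_block_start m a : computable m a -> computable m (fun v => block_start (a v)).
Proof.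
move=> Ha; have Hw := comp_win Ha; have Hs := comp_win_start Hw.
have Hb := comp_block_len Hw.
by apply: comp_addn => //; apply: comp_muln => //; apply: comp_divn => //; apply: comp_subn.
Qed.

Lemma comp_layer m a b c : computable m a -> computable m b -> computable m c ->
  computable m (fun v => layer (a v) (b v) (c v) : nat).
Proof.
move=> Ha Hb Hc; apply: comp_and; [apply: comp_eqn|apply: comp_leq].
- by apply: comp_modn => //; apply: comp_expn; [exact: comp_const|exact: comp_S].
- by apply: comp_expn; [exact: comp_const|].
- exact: comp_S.
- by apply: comp_expn; [exact: comp_const|apply/comp_S/comp_addn].
Qed.

Lemma comp_psi m a b : computable m a -> computable m b -> computable m (fun v => psi (a v) (b v)).
Proof.
apply: (@comp_fun2 _ psi).
apply: comp_if; [apply: comp_and|apply: comp_muln|apply: comp_if].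
- exact/comp_odd/comp_nth.
- apply: comp_leq; first exact/comp_S/comp_nth.
  by apply: comp_expn; [exact: comp_const|exact/comp_S/comp_nth].
- exact: comp_nth.
- by apply: comp_expn; [exact: comp_const|exact: comp_nth].
- apply: (@comp_ext _ (fun v => has (fun l => layer (nth 0 v 0) l.+1 (nth 0 v 1))
    (iota 0 (nth 0 v 0)) : nat)).
    by move=> v _; rewrite (iotaDl 1 0) has_map.
  apply: (@comp_has _ (fun l v => layer (nth 0 v 0) l.+1 (nth 0 v 1))); last exact: comp_nth.
  by apply: comp_layer; [exact: comp_nthb|exact/comp_S/comp_nth|exact: comp_nthb].
- exact/comp_half/comp_nth.
- exact: comp_nth.
Qed.

Lemma comp_digit m a k b : computable m a -> computable m k -> computable m b ->
  computable m (fun v => digit (nth false (decode (a v))) (k v) (b v)).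
Proof.
apply: (@comp_fun3 _ (fun x k b => digit (nth false (decode x)) k b)).
apply: (@comp_val2 _ (fun i v => nth false (decode (nth 0 v 0)) (nth 0 v 2 + i))).
  by apply: comp_nthd; [exact: comp_nthb|apply: comp_addn; [exact: comp_nthb|exact: comp_nth]].
exact/comp_block_len/comp_nth.
Qed.

(** The closure lemma is selected by the head symbol under the binder, and second-order patterns
    extract its arguments. *)
Ltac comp_step :=
  lazymatch goal with
  | |- computable _ (fun v => nth 0 v _) => apply: comp_nth
  | |- computable _ (fun v => nth 0 (behead v) _) => apply: comp_nthb
  | |- computable _ (fun v => nth 0 (behead (behead v)) _) => apply: comp_nthbb
  | |- computable _ (fun v => addn (@?a v) (@?b v)) => apply: (@comp_addn _ a b)
  | |- computable _ (fun v => subn (@?a v) (@?b v)) => apply: (@comp_subn _ a b)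
  | |- computable _ (fun v => muln (@?a v) (@?b v)) => apply: (@comp_muln _ a b)
  | |- computable _ (fun v => expn (@?a v) (@?b v)) => apply: (@comp_expn _ a b)
  | |- computable _ (fun v => divn (@?a v) (@?b v)) => apply: (@comp_divn _ a b)
  | |- computable _ (fun v => modn (@?a v) (@?b v)) => apply: (@comp_modn _ a b)
  | |- computable _ (fun v => S (@?a v)) => apply: (@comp_S _ a)
  | |- computable _ (fun v => predn (@?a v)) => apply: (@comp_predn _ a)
  | |- computable _ (fun v => double (@?a v)) => apply: (@comp_double _ a)
  | |- computable _ (fun v => depth (@?a v)) => apply: (@comp_depth _ a)
  | |- computable _ (fun v => block_len (@?a v)) => apply: (@comp_block_len _ a)
  | |- computable _ (fun v => win_len (@?a v)) => apply: (@comp_win_len _ a)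
  | |- computable _ (fun v => win_start (@?a v)) => apply: (@comp_win_start _ a)
  | |- computable _ (fun v => win (@?a v)) => apply: (@comp_win _ a)
  | |- computable _ (fun v => block_start (@?a v)) => apply: (@comp_block_start _ a)
  | |- computable _ (fun v => psi (@?a v) (@?b v)) => apply: (@comp_psi _ a b)
  | |- computable _ (fun v => digit (nth false (decode (@?a v))) (@?b v) (@?c v)) =>
      apply: (@comp_digit _ a b c)
  | |- computable _ (fun v => size (decode (@?a v))) => apply: (@comp_size _ a)
  | |- computable _ (fun v => nat_of_bool (nth false (decode (@?a v)) (@?b v))) =>
      apply: (@comp_nthd _ a b)
  | |- computable _ (fun v => nat_of_bool (bit (@?a v) (@?b v))) => apply: (@comp_bit _ a b)
  | |- computable _ (fun v => nat_of_bool (leq (@?a v) (@?b v))) => apply: (@comp_leq _ a b)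
  | |- computable _ (fun v => nat_of_bool (@eq_op _ (@?a v) (@?b v))) => apply: (@comp_eqn _ a b)
  | |- computable _ (fun v => nat_of_bool ((@?p v) && (@?q v))) => apply: (@comp_and _ p q)
  | |- computable _ (fun v => code (decode (@?a v))) => apply: (@comp_code_decode _ a)
  | |- computable _ (fun v => code (@cat _ (@?f v) (@?g v))) => refine (@comp_code_cat _ f g _ _)
  | |- computable _ (fun v => code (drop (@?i v) (decode (@?a v)))) => apply: (@comp_drop _ a i)
  | |- computable _ (fun v => code (mkseq (fun i => @?f i v) (@?a v))) =>
      refine (@comp_mkseq _ f a _ _)
  | |- computable _ (fun v => val2 (fun i => @?f i v) (@?a v)) =>
      refine (@comp_val2 _ f a _ _)
  | |- computable _ _ => first [apply: comp_const | apply: comp_ifb | apply: comp_if]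
  end.
Ltac comp_auto := cbv beta zeta; repeat (comp_step; cbv beta).

(* The advice [q] concerns the last, incomplete block.  Its first two bits are
   [1 b] for a shift to the right that lost the bit [b], [0 1] for a shift to the
   left and [0 0] for an unchanged block; the third one asks for the whole block,
   which is possible after a shift to the left. *)
Definition undo_bit (s q : seq bool) (i : nat) : bool :=
  let e := block_start (size s) in
  let D := depth (win (size s)) in
  if i < e then
    bit (psi (depth (win i)) (digit (nth false s) (win i) (block_start i))) (i - block_start i)
  else if nth false q 0 then (if i.+1 < size s then nth false s i.+1 else nth false q 1)
  else if nth false q 1 then (if i - e < D then false else nth false s (i - D))
  else nth false s i.

Definition undo (s q : seq bool) : seq bool :=
  mkseq (undo_bit s q)
    (if nth false q 2 then block_start (size s) + block_len (win (size s)) else size s).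

Lemma comp_undo : computable 2 (fun v => code (undo (decode (nth 0 v 0)) (decode (nth 0 v 1)))).
Proof.
rewrite /undo; apply: (@comp_mkseq _ (fun i v => undo_bit (decode (nth 0 v 0)) (decode (nth 0 v 1)) i)).
  by rewrite /undo_bit; comp_auto.
by comp_auto.
Qed.

(** Meant for an [s] ending at a block start, where it adds the known bits 0^D 1 of a marked
    block. *)
Definition append_marker (s : seq bool) : seq bool :=
  let D := depth (win (size s)) in s ++ mkseq (fun i => i == D) D.+1.

Lemma comp_append_marker :
  computable 2 (fun v => code (append_marker (decode (nth 0 v 0)))).
Proof.
by rewrite /append_marker; comp_auto. Qed.

Definition index_len k := 6 * k.+1 + 5.

(** A header whose length is known from [s] states how many bits follow; this makes the advice
    self-delimiting. *)
Definition jump_dom (s q : seq bool) : bool :=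
  let h := index_len (win (size s)) in
  (h <= size q) && (size q - h == val2 (fun i => nth false q i) h).

Definition jump (s q : seq bool) : seq bool := s ++ drop (index_len (win (size s))) q.

Lemma comp_jump_dom :
  computable 2 (fun v => jump_dom (decode (nth 0 v 0)) (decode (nth 0 v 1)) : nat).
Proof. by rewrite /jump_dom /index_len; comp_auto. Qed.

Lemma comp_jump :
  computable 2 (fun v => code (jump (decode (nth 0 v 0)) (decode (nth 0 v 1)))).
Proof. by rewrite /jump /index_len; comp_auto. Qed.

(** The first window start at or after [n]: if the last block of a window was just completed,
    nothing is left to fill. *)
Definition win_end n := if n == win_start (win n) then n else win_start (win n).+1.

Definition fill_dom (s q : seq bool) : bool := size q == win_end (size s) - size s.

Lemma comp_fill_dom :
  computable 2 (fun v => fill_dom (decode (nth 0 v 0)) (decode (nth 0 v 1)) : nat).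
Proof. by rewrite /fill_dom /win_end; comp_auto. Qed.

Lemma comp_cat2 : computable 2 (fun v => code (decode (nth 0 v 0) ++ decode (nth 0 v 1))).
Proof. by comp_auto. Qed.

(* [skip D] renumbers the blocks not starting with 0^D 1, leaving no gap. *)
Definition skip D d :=
  let u := d %% 2 ^ D.+1 in
  (u - (2 ^ D < u)) + (2 ^ D.+1).-1 * (d %/ 2 ^ D.+1).

Definition unskip D d :=
  let u := d %% (2 ^ D.+1).-1 in
  (if u < 2 ^ D then u else u.+1) + 2 ^ D.+1 * (d %/ (2 ^ D.+1).-1).

(** The number of unmarked blocks: the low D + 1 bits avoid one value, the high D bits are free. *)
Definition skip_base D := (2 ^ D.+1).-1 * 2 ^ D.

Definition expand_dom (s q : seq bool) : bool :=
  size q == win_len (win (size s)) - (win (size s)).+1.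

(** The advice is a single number in base [skip_base], whose digits are the renumbered blocks of the
    window. *)
Definition expand (s q : seq bool) : seq bool :=
  let k := win (size s) in
  s ++ mkseq (fun i => bit (unskip (depth k)
         (val2 (fun i => nth false q i) (size q) %/ skip_base (depth k) ^ (i %/ block_len k)
            %% skip_base (depth k))) (i %% block_len k)) (win_len k).

Lemma comp_expand_dom :
  computable 2 (fun v => expand_dom (decode (nth 0 v 0)) (decode (nth 0 v 1)) : nat).
Proof. by rewrite /expand_dom; comp_auto. Qed.

Lemma comp_expand :
  computable 2 (fun v => code (expand (decode (nth 0 v 0)) (decode (nth 0 v 1)))).
Proof. by rewrite /expand /unskip /skip_base; comp_auto. Qed.

(** * Correctness of the decoders *)

Lemma bit_shift d m i : bit (d %/ 2 ^ m) i = bit d (m + i).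
Proof. by rewrite /bit expnD divnMA. Qed.

Lemma bit_double d i : bit d.*2 i.+1 = bit d i.
Proof. by rewrite bitS doubleK. Qed.

Lemma bit_mod d m i : bit (d %% 2 ^ m) i = (i < m) && bit d i.
Proof.
have e0 n : 0 < 2 ^ n by rewrite expn_gt0.
case: ltnP => [im|mi] /=; last first.
  by rewrite /bit divn_small // (leq_trans (ltn_pmod _ (e0 m))) // leq_exp2l.
have E : d = d %/ 2 ^ m * 2 ^ (m - i) * 2 ^ i + d %% 2 ^ m.
  by rewrite -mulnA -expnD subnK ?(ltnW im) // -divn_eq.
by rewrite [in RHS]E /bit divnMDl // oddD oddM oddX subn_eq0 leqNgt im andbF.
Qed.

Lemma bit_exp D i : bit (2 ^ D) i = (i == D).
Proof.
rewrite /bit; case: (leqP i D) => iD; last first.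
  by rewrite divn_small ?ltn_exp2l //; case: eqP => // E; rewrite E ltnn in iD.
rewrite -(subnK iD) expnD mulnK ?expn_gt0 // oddX orbF subn_eq0.
by rewrite subnK // eqn_leq iD.
Qed.

(** The block around [n] starts with 0^D 1, as low bits come first. *)
Definition marked (z : real2) n :=
  digit z (win n) (block_start n) %% 2 ^ (depth (win n)).+1 == 2 ^ depth (win n).

Lemma bit_digit (z : real2) k b i : i < block_len k -> bit (digit z k b) i = z (b + i).
Proof. by move=> iB; rewrite bit_val2 iB. Qed.

Lemma marked_bits z n i : marked z n -> i <= depth (win n) ->
  z (block_start n + i) = (i == depth (win n)).
Proof.
move=> /eqP mk iD; rewrite -(@bit_digit _ (win n)); last by rewrite /block_len; lia.
by rewrite -bit_exp -mk bit_mod ltnS iD.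
Qed.

Lemma digit_mkseq (f : nat -> bool) N k b : b + block_len k <= N ->
  digit (nth false (mkseq f N)) k b = digit f k b.
Proof.
by move=> bN; apply: eq_val2 => i iB; rewrite nth_mkseq //; apply: leq_trans bN; rewrite ltn_add2l.
Qed.

Lemma undo_block z N q i : i < block_start N ->
  undo_bit (mkseq (transform z) N) q i = z i.
Proof.
move=> iN; rewrite /undo_bit size_mkseq iN.
have /andP[bi ib] := block_start_bounds i; have /andP[bN _] := block_start_bounds N.
rewrite digit_mkseq ?(leq_trans (prev_block iN)) // digit_transform psiK ?val2_lt //.
by rewrite bit_digit; [rewrite subnKC|lia].
Qed.

Lemma undo_transform z N : exists2 q, size q = 3 &
  undo (mkseq (transform z) N) q = mkseq z N.
Proof.
pose e := block_start N; pose D := depth (win N).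
suff [q [sq q2 Hq]] : exists q, [/\ size q = 3, ~~ nth false q 2 & forall i, i < N ->
    undo_bit (mkseq (transform z) N) q i = z i].
  exists q => //; apply: (@eq_from_nth _ false); rewrite /undo !size_mkseq (negPf q2) // => i iN.
  by rewrite !nth_mkseq // Hq.
have /andP[eN Ne] := block_start_bounds N.
have blk i : e <= i -> i < e + block_len (win N) -> win i = win N /\ block_start i = e.
  by move=> ei ie; have := @same_block N (i - e); rewrite subnKC //; apply; lia.
pose d := digit z (win N) e.
have dz i : e <= i -> i < e + block_len (win N) -> bit d (i - e) = z i.
  by move=> ei ie; rewrite bit_digit ?subnKC //; lia.
have tz i : e <= i -> i < e + block_len (win N) -> transform z i = bit (phi D d) (i - e).
  by move=> ei /(blk _ ei)[wE bE]; rewrite /transform wE bE.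
have [cpy|[shr|shl]] : phi D d = d \/ (d %% 2 ^ D.+1 == 2 ^ D /\ phi D d = d %/ 2 ^ D) \/ phi D d = d.*2.
  by rewrite /phi; case: ifP; [right; left|case: ifP; [right; right|left]].
- exists [:: false; false; false]; split=> // i iN.
  have [ie|ei] := ltnP i e; first by rewrite undo_block.
  by rewrite /undo_bit size_mkseq ltnNge ei /= nth_mkseq // tz ?cpy ?dz //; lia.
- case: shr => mk shr; exists [:: false; true; false]; split=> // i iN.
  have [ie|ei] := ltnP i e; first by rewrite undo_block.
  rewrite /undo_bit size_mkseq ltnNge ei /= -/D -/e; case: ltnP => iD.
    have := @marked_bits z N (i - e) mk; rewrite subnKC // => -> //; last by rewrite -/D; lia.
    by rewrite -/D; lia.
  rewrite nth_mkseq; last by lia.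
  rewrite tz; [|lia|lia].
  by rewrite shr bit_shift -dz //; [congr bit; lia|lia].
(* Doubling puts bit [i] of [z] at place i + 1, so only the last bit of the prefix has left it; the
   advice carries this bit. *)
- exists [:: true; z N.-1; false]; split=> // i iN.
  have [ie|ei] := ltnP i e; first by rewrite undo_block.
  rewrite /undo_bit size_mkseq ltnNge ei /=; case: ltnP => iN1.
    by rewrite nth_mkseq // tz ?shl ?subSn ?bit_double ?dz //; lia.
  by congr z; lia.
Qed.

(** The block is 2^D o and its image is o, so the D + 1 image bits read are exactly the bits of the
    block after its D zeros. *)
Lemma undo_marked z n : marked z n ->
  let e := block_start n in
  undo (mkseq (transform z) (e + (depth (win n)).+1)) [:: false; true; true] =
  mkseq z (e + block_len (win n)).
Proof.
(* As D > 0, position e + D + 1 still lies inside the block, and the decoder finds the right window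
   and block start. *)
move=> mk e; set D := depth (win n); have D0 : 0 < D by rewrite /D /depth; lia.
have [|wE bE] := @same_block n D.+1; first by rewrite /block_len -/D; lia.
rewrite -/e in wE bE.
apply: (@eq_from_nth _ false); rewrite /undo !size_mkseq wE bE // => i iB.
rewrite !nth_mkseq //; have [ie|ei] := ltnP i e.
  by rewrite undo_block // bE.
rewrite /undo_bit size_mkseq wE bE ltnNge ei /= -/D; case: ltnP => iD.
  have := @marked_bits z n (i - e) mk; rewrite subnKC // => -> //; last by rewrite -/D; lia.
  by rewrite -/D; lia.
have iB2 : i < e + D.*2.+1 by [].
rewrite nth_mkseq; last by lia.
have := @same_block n (i - D - e); rewrite subnKC; last by lia.
case; first by rewrite /block_len -/D; lia.
move=> wE' bE'; rewrite /transform wE' bE' /phi -/D.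
move: (mk); rewrite /marked -/D -/e => ->; rewrite bit_shift bit_digit.
  by congr z; lia.
by rewrite /block_len -/D; lia.
Qed.

Lemma mkseqD (z : real2) m n : mkseq z m ++ mkseq (fun i => z (m + i)) n = mkseq z (m + n).
Proof.
apply: (@eq_from_nth _ false); rewrite size_cat !size_mkseq // => i iN.
rewrite nth_cat size_mkseq [in RHS]nth_mkseq //; case: ltnP => im; first by rewrite nth_mkseq.
by rewrite nth_mkseq ?subnKC //; lia.
Qed.

Lemma append_marker_marked z n : marked z n ->
  let e := block_start n in
  append_marker (mkseq z e) = mkseq z (e + (depth (win n)).+1).
Proof.
move=> mk e; rewrite /append_marker size_mkseq -mkseqD; congr (_ ++ _).
have [|wE bE] := @same_block n 0; first by [].
rewrite addn0 in wE; rewrite wE; apply: (@eq_from_nth _ false); rewrite !size_mkseq // => i iD.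
by rewrite !nth_mkseq // marked_bits.
Qed.

Lemma win_win_start k : win (win_start k) = k.
Proof. by apply: win_eq; rewrite leqnn win_start_ltn. Qed.

Lemma win_len_le k : win_len k <= 2 ^ index_len k.
Proof.
rewrite /win_len /block_count /index_len.
(* A block has 8(k+1) + 1 <= 2^(k+5) bits, and the exponents k + 5 and 5(k+1) + 1 add up to 6(k+1) +
   5. *)
apply: (@leq_trans (2 ^ (k.+1 + 4) * 2 ^ (5 * k.+1).+1)); last first.
  by rewrite -expnD leq_exp2l //; lia.
rewrite leq_mul2r expnD; have := ltn_expl k.+1 (isT : 1 < 2).
by rewrite /block_len /depth; lia.
Qed.

Lemma jump_mkseq z N : let k := win N in
  exists q, [/\ jump_dom (mkseq z (win_start k)) q,
    size q = index_len k + (N - win_start k) & jump (mkseq z (win_start k)) q = mkseq z N].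
Proof.
move=> k; have /andP[kN Nk] := win_bounds N; rewrite -/k in kN Nk.
pose u := mkseq (bit (N - win_start k)) (index_len k).
have su : size u = index_len k by rewrite size_mkseq.
exists (u ++ mkseq (fun i => z (win_start k + i)) (N - win_start k)).
rewrite /jump_dom /jump size_mkseq win_win_start drop_size_cat // mkseqD subnKC //.
rewrite size_cat su size_mkseq leq_addr addKn andTb; split=> //.
rewrite -{1}(@val2_bit (N - win_start k) (index_len k)); last first.
  by apply: leq_trans (win_len_le k); rewrite win_startS in Nk; lia.
by apply/eqP/eq_val2 => i ih; rewrite nth_cat su ih nth_mkseq.
Qed.

Lemma fill_mkseq z N : exists q, [/\ fill_dom (mkseq z N) q,
  size q = win_end N - N & mkseq z N ++ q = mkseq z (win_end N)].
Proof.
exists (mkseq (fun i => z (N + i)) (win_end N - N)).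
rewrite /fill_dom !size_mkseq mkseqD; split=> //; rewrite subnKC // /win_end.
by case: eqP => // _; have /andP[_ /ltnW] := win_bounds N.
Qed.

Lemma win_end_block n : win_end (block_start n + block_len (win n)) = win_start (win n).+1.
Proof.
have [le1 le2] := block_in_win n; rewrite /win_end.
move: le2; rewrite leq_eqVlt => /orP[/eqP->|lt2]; first by rewrite win_win_start eqxx.
rewrite (@win_eq (win n)); last by rewrite lt2 andbT; lia.
by rewrite ifN //; have : 0 < block_len (win n) by []; lia.
Qed.

Lemma unskipK D d : d %% 2 ^ D.+1 != 2 ^ D -> unskip D (skip D d) = d.
Proof.
rewrite /unskip /skip; set u := d %% _; set v := d %/ _ => uD.
have uX : u < 2 ^ D.+1 by rewrite ltn_pmod ?expn_gt0.
have D0 : 0 < 2 ^ D by rewrite expn_gt0.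
have XE : 2 ^ D.+1 = 2 ^ D + (2 ^ D).-1.+1 by rewrite expnS; lia.
have u'X : u - (2 ^ D < u) < (2 ^ D.+1).-1 by case: ltnP; lia.
rewrite [_ - _ + _]addnC [_.-1 * v]mulnC modnMDl modn_small // divnMDl; last by lia.
rewrite divn_small // addn0 [RHS](divn_eq d (2 ^ D.+1)) -/u -/v addnC mulnC.
congr (_ + _); case: (ltnP (2 ^ D) u) => h; last by rewrite subn0 ifT; lia.
by rewrite ifN; lia.
Qed.

Lemma skip_lt D d : d < 2 ^ D.*2.+1 -> d %% 2 ^ D.+1 != 2 ^ D -> skip D d < skip_base D.
Proof.
move=> dB; rewrite /skip /skip_base; set u := d %% _ => uD.
have uX : u < 2 ^ D.+1 by rewrite ltn_pmod ?expn_gt0.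
have D0 : 0 < 2 ^ D by rewrite expn_gt0.
have vD : d %/ 2 ^ D.+1 < 2 ^ D.
  by rewrite ltn_divLR ?expn_gt0 // -expnD addnS addnn.
have u'X : u - (2 ^ D < u) < (2 ^ D.+1).-1 by rewrite expnS; rewrite expnS in uX; case: ltnP; lia.
apply: (@leq_trans ((2 ^ D.+1).-1 * (d %/ 2 ^ D.+1).+1)); first by rewrite mulnS ltn_add2r.
by rewrite leq_mul2l vD orbT.
Qed.

(** * Base expansions and the count of windows without marked blocks *)

Definition horner Y (a : nat -> nat) G := \sum_(0 <= j < G) a j * Y ^ j.

Lemma hornerS Y a G : horner Y a G.+1 = a 0 + horner Y (fun j => a j.+1) G * Y.
Proof.
rewrite /horner big_nat_recl // muln1 big_distrl /=; congr (_ + _).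
by apply: eq_bigr => j _; rewrite expnSr mulnA.
Qed.

Lemma horner_lt Y a G : (forall j, j < G -> a j < Y) -> horner Y a G < Y ^ G.
Proof.
elim: G a => [|G IH] a aY; first by rewrite /horner big_geq.
rewrite hornerS expnSr; have h := IH (fun j => a j.+1) (fun j => aY j.+1).
have a0 := aY 0 isT; apply: (@leq_trans ((horner Y (fun j => a j.+1) G).+1 * Y)).
  by rewrite mulSn ltn_add2r.
by rewrite leq_mul2r h orbT.
Qed.

Lemma horner_digit Y a G j : (forall j, j < G -> a j < Y) -> j < G ->
  horner Y a G %/ Y ^ j %% Y = a j.
Proof.
elim: G a j => [|G IH] a [|j] // aY jG; have a0 := aY 0 isT; have Y0 : 0 < Y by lia.
  by rewrite hornerS divn1 addnC modnMDl modn_small.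
rewrite hornerS expnS divnMA addnC divnMDl // [a 0 %/ _]divn_small // addn0.
by rewrite (IH (fun j => a j.+1) j (fun j => aY j.+1)).
Qed.

Lemma bernoulli n m : n ^ m.+1 + m.+1 * n ^ m <= n.+1 ^ m.+1.
Proof.
elim: m => [|m IH]; first by rewrite !expn1 expn0; lia.
rewrite [n.+1 ^ _]expnS; apply: (@leq_trans (n.+1 * (n ^ m.+1 + m.+1 * n ^ m))); last first.
  by rewrite leq_mul2l IH orbT.
by rewrite ![n ^ _.+1]expnS; nia.
Qed.

(** This is (1 - 1/X)^X <= 1/2, raised to the power t. With X = n + 1, [bernoulli] bounds
    (n+1)^(n+1) below by n^(n+1) + (n+1) n^n, which is at least 2 n^(n+1). *)
Lemma pred_expn_le X t : 0 < X -> X.-1 ^ (X * t) * 2 ^ t <= X ^ (X * t).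
Proof.
case: X => // n _; rewrite !expnM -expnMn; case: t => // t.
rewrite leq_exp2r //= mulnC mul2n -addnn; apply: leq_trans (bernoulli n n).
by rewrite leq_add2l expnS; nia.
Qed.

(** With X = 2^(D+1) there are X 2^(k+1) blocks, so the fraction of windows without a marked block
    is (1 - 1/X)^(X 2^(k+1)) <= 2^-(2^(k+1)) <= 2^-(k+1). *)
Lemma skip_base_le k :
  skip_base (depth k) ^ block_count k <= 2 ^ (win_len k - k.+1).
Proof.
have kG : k.+1 <= win_len k.
  rewrite /win_len /block_count; have := ltn_expl (5 * k.+1).+1 (isT : 1 < 2).
  by rewrite /block_len; nia.
rewrite -(@leq_pmul2r (2 ^ k.+1)) ?expn_gt0 // -expnD subnK //.
set D := depth k; have GE : block_count k = 2 ^ D.+1 * 2 ^ k.+1.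
  by rewrite -expnD /block_count /D /depth; congr (2 ^ _); lia.
have Gk : 2 ^ k.+1 <= 2 ^ (2 ^ k.+1) by rewrite leq_exp2l // ltnW // ltn_expl.
rewrite /win_len /block_len -/D /skip_base expnMn -expnM.
apply: (@leq_trans ((2 ^ D.+1).-1 ^ block_count k * 2 ^ (D * block_count k) * 2 ^ (2 ^ k.+1))).
  by rewrite leq_mul2l Gk orbT.
rewrite mulnAC GE; apply: leq_trans (leq_mul (pred_expn_le _ _) (leqnn _)) _; first by rewrite expn_gt0.
by rewrite -expnM -expnD leq_exp2l // -mulnDl; apply: leq_mul; lia.
Qed.

Lemma expand_mkseq z k :
  (forall j, j < block_count k -> ~~ marked z (win_start k + j * block_len k)) ->
  exists q, [/\ expand_dom (mkseq z (win_start k)) q, size q = win_len k - k.+1 &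
    expand (mkseq z (win_start k)) q = mkseq z (win_start k.+1)].
Proof.
move=> unm; pose D := depth k.
pose d j := digit z k (win_start k + j * block_len k).
have dmod j : j < block_count k -> d j %% 2 ^ D.+1 != 2 ^ D.
  move=> jG; have := unm j jG; rewrite /marked.
  have [|wE bE] := @block_start_eq k j 0 jG; first by [].
  by rewrite addn0 in wE bE; rewrite wE bE.
pose V := horner (skip_base D) (fun j => skip D (d j)) (block_count k).
have sk j : j < block_count k -> skip D (d j) < skip_base D.
  by move=> jG; apply: skip_lt (dmod j jG); apply: val2_lt.
have VL : V < 2 ^ (win_len k - k.+1) := leq_trans (horner_lt sk) (skip_base_le k).
exists (mkseq (bit V) (win_len k - k.+1)).
rewrite /expand_dom /expand !size_mkseq win_win_start eqxx; split=> //.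
rewrite win_startS -mkseqD; congr (_ ++ _).
apply: (@eq_from_nth _ false); rewrite !size_mkseq // => i iL.
have B0 : 0 < block_len k by [].
have jG : i %/ block_len k < block_count k by rewrite ltn_divLR // mulnC.
rewrite !nth_mkseq // (@eq_val2 _ (bit V)) => [|l lL]; last by rewrite nth_mkseq.
rewrite val2_bit // horner_digit // unskipK ?dmod // bit_digit ?ltn_pmod //.
by congr z; have := divn_eq i (block_len k); lia.
Qed.

(** * Complexity along the windows *)

Lemma prefix_size_eq (q q' : seq bool) : prefix q q' -> size q = size q' -> q = q'.
Proof. by rewrite prefixE => /eqP + E; rewrite E take_size. Qed.

Lemma K_undo U : optimal U ->
  exists c, forall s q, size q = 3 -> K U (undo s q) <= K U s + c.
Proof.
move=> optU; case: (@K_extension U (fun _ q => size q == 3) undo) => //.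
- by comp_auto.
- exact: comp_undo.
- by move=> s q q' /eqP h /eqP h' /prefix_size_eq; apply; rewrite h h'.
by move=> c Hc; exists (3 + c) => s q sq; have := Hc s q; rewrite sq eqxx => /(_ isT); lia.
Qed.

Lemma K_append_marker U : optimal U ->
  exists c, forall s, K U (append_marker s) <= K U s + c.
Proof.
move=> optU; case: (@K_extension U (fun _ q => size q == 0) (fun s _ => append_marker s)) => //.
- by comp_auto.
- exact: comp_append_marker.
- by move=> s q q' /eqP h /eqP h' /prefix_size_eq; apply; rewrite h h'.
by move=> c Hc; exists c => s; have := Hc s [::] isT; rewrite addn0.
Qed.

(** Serves both to reach a marked block inside a window and, at the end, to bound the complexity of
    arbitrary prefixes. *)
Lemma K_jump U : optimal U -> exists c, forall z N,
  K U (mkseq z N) <= K U (mkseq z (win_start (win N))) +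
    (index_len (win N) + (N - win_start (win N))) + c.
Proof.
move=> optU; case: (@K_extension U jump_dom jump) => //.
- exact: comp_jump_dom.
- exact: comp_jump.
(* Comparable advice strings share the header, which fixes their length. *)
- move=> s q q' /andP[h /eqP e] /andP[h' /eqP e'] pre; apply: (prefix_size_eq pre).
  suff : size q - index_len (win (size s)) = size q' - index_len (win (size s)) by lia.
  rewrite e e'; apply: eq_val2 => i ih; have /prefixP[t ->] := pre.
  by rewrite nth_cat (leq_trans ih).
move=> c Hc; exists c => z N; have [q [dq sq E]] := jump_mkseq z N.
by have := Hc _ _ dq; rewrite E sq.
Qed.

Lemma K_fill U : optimal U -> exists c, forall z N,
  K U (mkseq z (win_end N)) <= K U (mkseq z N) + (win_end N - N) + c.
Proof.
move=> optU; case: (@K_extension U fill_dom cat) => //.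
- exact: comp_fill_dom.
- exact: comp_cat2.
- by move=> s q q' /eqP h /eqP h' /prefix_size_eq; apply; rewrite h h'.
move=> c Hc; exists c => z N; have [q [dq sq E]] := fill_mkseq z N.
by have := Hc _ _ dq; rewrite E sq.
Qed.

Lemma K_expand U : optimal U -> exists c, forall z k,
  (forall j, j < block_count k -> ~~ marked z (win_start k + j * block_len k)) ->
  K U (mkseq z (win_start k.+1)) <= K U (mkseq z (win_start k)) + (win_len k - k.+1) + c.
Proof.
move=> optU; case: (@K_extension U expand_dom expand) => //.
- exact: comp_expand_dom.
- exact: comp_expand.
- by move=> s q q' /eqP h /eqP h' /prefix_size_eq; apply; rewrite h h'.
move=> c Hc; exists c => z k unm; have [q [dq sq E]] := expand_mkseq unm.
by have := Hc _ _ dq; rewrite E sq.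
Qed.

Lemma le_K_transform U z : optimal U -> le_K U z (transform z).
Proof.
move=> /K_undo[c Hc]; exists c => n.
by have [q sq <-] := undo_transform z n; apply: Hc.
Qed.

(** From the prefix ending at the block start, append 0^D 1; by hypothesis the prefix of
    [transform z] of this length is no more complex up to a constant, and [undo_marked] obtains the
    whole block from it. *)
Lemma K_marked_block U z : optimal U -> le_K U (transform z) z ->
  exists c, forall n, marked z n ->
    K U (mkseq z (block_start n + block_len (win n))) <= K U (mkseq z (block_start n)) + c.
Proof.
move=> optU [c0 H0]; have [c1 H1] := K_undo optU; have [c2 H2] := K_append_marker optU.
exists (c2 + c0 + c1) => n mk.
have := H1 (mkseq (transform z) (block_start n + (depth (win n)).+1)) [:: false; true; true] erefl.
rewrite (undo_marked mk); have := H2 (mkseq z (block_start n)).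
rewrite (append_marker_marked mk); have := H0 (block_start n + (depth (win n)).+1).
lia.
Qed.

Lemma K_window U z : optimal U -> le_K U (transform z) z -> exists c, forall k,
  K U (mkseq z (win_start k.+1)) + k.+1 <= K U (mkseq z (win_start k)) + win_len k + c.
Proof.
move=> optU leT; have [c1 H1] := K_marked_block optU leT.
have [c2 H2] := K_jump optU; have [c3 H3] := K_fill optU; have [c4 H4] := K_expand optU.
(* With a marked block, a block of 8(k+1) + 1 bits is saved at the price of a header of 6(k+1) + 5
   bits. The net saving is 2(k+1) - 4 up to the other constants; the 4 absorbs this deficit. *)
exists (4 + c1 + c2 + c3 + c4) => k.
case: (pselect (forall j, j < block_count k -> ~~ marked z (win_start k + j * block_len k))).
  move/H4; have : k.+1 <= win_len k; last by lia.
  rewrite /win_len /block_count; have := ltn_expl (5 * k.+1).+1 (isT : 1 < 2).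
  by rewrite /block_len; nia.
move=> /existsNP[j /not_implyP[jG /negP]]; rewrite negbK => mk.
have [|wE bE] := @block_start_eq k j 0 jG; first by [].
rewrite addn0 in wE bE; set e := win_start k + _ in mk wE bE *.
have := H1 e mk; rewrite wE bE => M1; have := H2 z e; rewrite wE => M2.
have := H3 z (e + block_len k); have := win_end_block e; rewrite bE wE => -> M3.
have [_] := block_in_win e; rewrite bE wE win_startS in M3 *.
by move: M1 M2 M3; rewrite /index_len /block_len /depth /e; lia.
Qed.

(** The savings of the windows sum to about k^2/2, against a loss of [c] in each; doubling
    everything avoids fractions. *)
Lemma K_win_start U z : optimal U -> le_K U (transform z) z -> exists c, forall k,
  2 * K U (mkseq z (win_start k)) + k * k <= 2 * win_start k + c * k + c.
Proof.
move=> optU leT; have [c Hc] := K_window optU leT.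
exists (2 * c + 2 * K U (mkseq z 0)); elim=> [|k IH].
  by rewrite /win_start big_geq //; lia.
by have := Hc k; rewrite win_startS in IH *; nia.
Qed.

Lemma random_above U z : optimal U -> le_K U (transform z) z ->
  exists r, lt_K U z r.
Proof.
move=> optU leT; have [r Hr] := random_real optU; exists r.
have [c Hc] := K_win_start optU leT; have [c2 H2] := K_jump optU.
split.
  exists ((c + 12) * (c + 12) + c + 11 + c2) => N; have := Hc (win N); have := H2 z N.
  have /andP[wN _] := win_bounds N; have := Hr N; rewrite /index_len.
  move: (win N) wN => k wN; move: (K _ _) (K _ _) (K _ _) => a b d h1 h2 h3.
  (* After doubling, the window losses c k and the header's 12 k make up the linear term. It is at
     most (c+12)^2 if k <= c + 12, and at most k^2 otherwise. *)
  have : (c + 12) * k <= (c + 12) * (c + 12) + k * k by nia.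
  nia.
(* At a window start, r <=_K z would give k^2 <= c k + c + 2c', which fails for k = 2c' + 2c + 2. *)
move=> [c' H']; have := H' (win_start (2 * c' + 2 * c + 2)).
have := Hr (win_start (2 * c' + 2 * c + 2)); have := Hc (2 * c' + 2 * c + 2).
nia.
Qed.

Theorem theorem1p1 (U : machine) (hU : optimal U) :
  (~ exists D : set real2, maximal_K_degree U D) /\
  (forall z : real2, exists zhat : real2, lt_K U z zhat).
Proof.
(* Either [transform z] is itself strictly above [z], or it lies below [z] as well and a random real
   is strictly above. *)
have above z : exists zhat, lt_K U z zhat.
  case: (pselect (le_K U (transform z) z)) => [/(random_above hU) //|nle].
  by exists (transform z); split=> //; apply: le_K_transform.
by split=> // -[D [z _]]; apply.
Qed.
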